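(* Let $n\ge1$. For all $s,s'\in\{1,\dots,1+n\}$ the algebras $\mathcal A(M_{\mathrm{red}}^{(s)})$ and $\mathcal A(M_{\mathrm{red}}^{(s')})$, each with the pointwise product, are isomorphic as unital Fréchet algebras (i.e. there is a unital algebra isomorphism between them which is a homeomorphism).
   Context: For $s\in\{1,\dots,1+n\}$ let $\nu_k=+1$ for $0\le k\le s-1$ and $\nu_k=-1$ for $s\le k\le n$. On $\mathbb C^{1+n}$ with standard coordinates $z^0,\dots,z^n$ put $J^{(s)}=\sum_{k=0}^n\nu_k z^k\bar z^k$, $Z^{(s)}=(J^{(s)})^{-1}(\{1\})$ and $M^{(s)}_{\mathrm{red}}=Z^{(s)}/U(1)$ ($U(1)$ acting by scalar multiplication), identified with the open complex submanifold $\{[\rho]: J^{(s)}(\rho)>0\}$ of $\mathbb{CP}^n$. Let $\hat J^{(s)}(\xi,\eta)=\sum_{k=0}^n\nu_k\xi^k\eta^k$ on $\mathbb C^{1+n}\times\mathbb C^{1+n}$, $\hat Z^{(s)}=(\hat J^{(s)})^{-1}(\{1\})$ and $\hat M^{(s)}_{\mathrm{red}}=\hat Z^{(s)}/\mathbb C^*$, where $\alpha\in\mathbb C^*$ acts by $(\xi,\eta)\mapsto(\alpha\xi,\alpha^{-1}\eta)$; this is a complex manifold, identified with the open subset $\{([\xi],[\eta]):\hat J^{(s)}(\xi,\eta)\neq0\}$ of $\mathbb{CP}^n\times\mathbb{CP}^n$. Let $\Delta_{\mathrm{red}}^{(s)}:M^{(s)}_{\mathrm{red}}\to\hat M^{(s)}_{\mathrm{red}}$,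 $[\rho]\mapsto[(\rho,\bar\rho)]$ for $\rho\in Z^{(s)}$. Then $\mathcal A(M^{(s)}_{\mathrm{red}})=\{\hat g\circ\Delta^{(s)}_{\mathrm{red}}:\hat g\in\mathcal O(\hat M^{(s)}_{\mathrm{red}})\}$, where $\mathcal O$ denotes holomorphic functions; the extension $\hat g$ of $g=\hat g\circ\Delta^{(s)}_{\mathrm{red}}$ is unique, and $\mathcal A(M^{(s)}_{\mathrm{red}})$ carries the Fréchet topology of locally uniform convergence of the extensions $\hat g$ on $\hat M^{(s)}_{\mathrm{red}}$. *)

(* Defs.v *)
From HB Require Import structures.
From mathcomp Require Import all_boot all_order all_algebra.
From mathcomp Require Import generic_quotient complex.
From mathcomp Require Import all_classical all_reals all_analysis.

Set Implicit Arguments.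
Unset Strict Implicit.
Unset Printing Implicit Defensive.

Import Order.TTheory GRing.Theory Num.Theory.
Import numFieldNormedType.Exports.

Local Open Scope quotient_scope.
Local Open Scope classical_set_scope.
Local Open Scope ring_scope.

(* R[i] as a normed space over itself, as the library does for the abstract
   numerical fields. *)
HB.instance Definition _ (R : rcfType) := GRing.ComAlgebra.copy R[i] R[i]^o.
HB.instance Definition _ (R : rcfType) := Vector.copy R[i] R[i]^o.
HB.instance Definition _ (R : rcfType) := NormedModule.copy R[i] R[i]^o.

Section ReducedSpaces.
Variables (R : realType) (n s : nat).
Local Notation C := (R[i]).

Definition nu (k : 'I_n.+1) : C := if (k < s)%N then 1 else -1.

Lemma nuM k : nu k * nu k = 1.
Proof. by rewrite /nu; case: ifP => _; rewrite ?mulrNN mulr1. Qed.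

Definition J (z : 'rV[C]_n.+1) : C :=
  \sum_(k < n.+1) nu k * (z 0 k * Num.conj (z 0 k)).

Definition Z : set 'rV[C]_n.+1 := [set z | J z = 1].

Definition U1_rel (z w : Z) : bool :=
  `[< exists2 a : C, `|a| = 1 & set_val w = a *: set_val z >].

Lemma U1_rel_equiv : equiv_class_of U1_rel.
Proof.
split=> [z | z w | w z v].
- by apply/asboolP; exists 1; rewrite ?normr1 ?scale1r.
- have sym (x y : Z) : U1_rel x y -> U1_rel y x.
    move=> /asboolP[a a1 e]; apply/asboolP; exists a^-1.
      by rewrite normfV a1 invr1.
    rewrite e scalerA mulVf ?scale1r//.
    by rewrite -normr_eq0 a1 oner_eq0.
  by apply/idP/idP; exact: sym.
- move=> /asboolP[a a1 e] /asboolP[b b1 f]; apply/asboolP; exists (b * a).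
    by rewrite normrM a1 b1 mulr1.
  by rewrite f e scalerA.
Qed.

Canonical U1_equiv := EquivRelPack U1_rel_equiv.

Definition Mred : Type := {eq_quot U1_equiv}.
HB.instance Definition _ := Choice.on Mred.
HB.instance Definition _ := Quotient.on Mred.

Definition hatJ (p : 'rV[C]_n.+1 * 'rV[C]_n.+1) : C :=
  \sum_(k < n.+1) nu k * (p.1 0 k * p.2 0 k).

Definition hatZ : set ('rV[C]_n.+1 * 'rV[C]_n.+1) := [set p | hatJ p = 1].

Definition Cstar_rel (p q : hatZ) : bool :=
  `[< exists2 a : C, a != 0 &
        set_val q = (a *: (set_val p).1, a^-1 *: (set_val p).2) >].

Lemma Cstar_rel_equiv : equiv_class_of Cstar_rel.
Proof.
split=> [p | p q | q p r].
- apply/asboolP; exists 1; first exact: oner_neq0.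
  by rewrite invr1 !scale1r; case: (set_val p).
- have sym (x y : hatZ) : Cstar_rel x y -> Cstar_rel y x.
    move=> /asboolP[a a0 e]; apply/asboolP; exists a^-1; rewrite ?invr_eq0//.
    rewrite e/= !scalerA mulVf// mulVf ?invr_eq0// !scale1r.
    by case: (set_val x).
  by apply/idP/idP; exact: sym.
- move=> /asboolP[a a0 e] /asboolP[b b0 f]; apply/asboolP; exists (b * a).
    by rewrite mulf_neq0.
  by rewrite f e/= !scalerA invfM.
Qed.

Canonical Cstar_equiv := EquivRelPack Cstar_rel_equiv.

(* Quotient of the subspace topology on hatZ. *)
Definition hatMred : Type := quotient_topology {eq_quot Cstar_equiv}.
HB.instance Definition _ := Topological.on hatMred.
HB.instance Definition _ := Quotient.on hatMred.

Lemma diagZ_subproof (z : Z) :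
  (set_val z, map_mx Num.conj (set_val z)) \in hatZ.
Proof.
apply/mem_set; rewrite /hatZ/= /hatJ/=.
under eq_bigr do rewrite mxE.
exact: (set_mem (valP z)).
Qed.

Definition diagZ (z : Z) : hatZ := SigSub (diagZ_subproof z).

Definition Delta (x : Mred) : hatMred := \pi_hatMred (diagZ (repr x)).

Lemma Delta_pi (z : Z) : Delta (\pi_Mred z) = \pi_hatMred (diagZ z).
Proof.
rewrite /Delta.
have /eqmodP/asboolP[a a1 e] : z = repr (\pi_Mred z) %[mod {eq_quot U1_equiv}].
  by rewrite reprK.
apply/esym/eqmodP/asboolP; exists a; first by rewrite -normr_eq0 a1 oner_eq0.
rewrite [LHS]/=; congr (_, _); first exact: e.
rewrite /=.
rewrite e; apply/matrixP => i j; rewrite !mxE rmorphM/=.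
by rewrite invC_norm a1 expr1n invr1 mul1r.
Qed.

(* Homogeneous coordinates [u_0 : ... : 1 : ... : u_(n-1)], with 1 in slot i. *)
Definition homog (i : 'I_n.+1) (u : 'rV[C]_n) : 'rV[C]_n.+1 :=
  \row_k (if unlift i k is Some j then u 0 j else 1).

Lemma hatZ0_subproof :
  (delta_mx 0 ord0, nu ord0 *: delta_mx 0 ord0) \in hatZ.
Proof.
apply/mem_set; rewrite /hatZ/= /hatJ/= (bigD1 ord0)//= big1 => [|k k0].
  by rewrite !mxE !eqxx !mulr1 mul1r nuM addr0.
by rewrite !mxE (negbTE k0) mul0r mulr0.
Qed.

Definition hatZ0 : hatZ := SigSub hatZ0_subproof.

(* The point of hatMred corresponding to ([xi], [eta]) when hatJ (xi, eta) != 0;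
   the value [hatZ0] taken when hatJ (xi, eta) = 0 is irrelevant. *)
Definition hat_point (p : 'rV[C]_n.+1 * 'rV[C]_n.+1) : hatMred :=
  \pi_hatMred (insubd hatZ0 ((hatJ p)^-1 *: p.1, p.2)).

Lemma hatJZ (a b : C) (p : 'rV[C]_n.+1 * 'rV[C]_n.+1) :
  hatJ (a *: p.1, b *: p.2) = a * b * hatJ p.
Proof.
rewrite /hatJ mulr_sumr; apply: eq_bigr => k _ /=.
by rewrite !mxE mulrACA [LHS]mulrCA.
Qed.

Lemma hat_point_subproof (p : 'rV[C]_n.+1 * 'rV[C]_n.+1) :
  hatJ p != 0 ->
  ((hatJ p)^-1 *: p.1, p.2) \in hatZ.
Proof.
move=> p0; apply/mem_set; rewrite /hatZ/= -[p.2 in LHS]scale1r hatJZ mulr1.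
exact: mulVf.
Qed.

Lemma hat_point_val (p : hatZ) : hat_point (set_val p) = \pi_hatMred p.
Proof.
rewrite /hat_point; congr (\pi_hatMred _); apply: val_inj.
have pJ : hatJ (set_val p) = 1 := set_mem (valP p).
rewrite val_insubd pJ invr1 scale1r -surjective_pairing.
by have -> : set_val p \in hatZ by exact: valP p.
Qed.

Lemma hat_pointZ (a b : C) (p : 'rV[C]_n.+1 * 'rV[C]_n.+1) :
  a != 0 -> b != 0 -> hatJ p != 0 ->
  hat_point (a *: p.1, b *: p.2) = hat_point p.
Proof.
move=> a0 b0 p0.
have q0 : hatJ (a *: p.1, b *: p.2) != 0 by rewrite hatJZ !mulf_neq0.
apply/esym/eqmodP/asboolP; exists b^-1; first by rewrite invr_eq0.
rewrite set_valE !val_insubd (hat_point_subproof p0) (hat_point_subproof q0) /= hatJZ.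
rewrite invrK !scalerA; congr (_ *: _, _).
by rewrite -[a * b * _]mulrA [a * (b * _)]mulrC invfM -mulrA mulVf// mulr1 invfM.
Qed.

(* The inverses of the affine charts of CP^n x CP^n, restricted to hatMred; the
   domain of definition of [hat_chart i j] is the open set
   {(u, v) : hatJ (homog i u, homog j v) != 0}. *)
Definition hat_chart (i j : 'I_n.+1) (p : 'rV[C]_n * 'rV[C]_n) : hatMred :=
  hat_point (homog i p.1, homog j p.2).

Definition holomorphic (gh : hatMred -> C) : Prop :=
  forall (i j : 'I_n.+1) (p : 'rV[C]_n * 'rV[C]_n),
    hatJ (homog i p.1, homog j p.2) != 0 ->
    differentiable (gh \o hat_chart i j) p.

Lemma holomorphic_cst (c : C) : holomorphic (cst c).
Proof. by move=> i j p _; exact: differentiable_cst. Qed.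

Lemma holomorphicB (g h : hatMred -> C) :
  holomorphic g -> holomorphic h -> holomorphic (g - h).
Proof. by move=> gP hP i j p p0; apply: differentiableB; [exact: gP|exact: hP]. Qed.

Lemma holomorphicM (g h : hatMred -> C) :
  holomorphic g -> holomorphic h -> holomorphic (g * h).
Proof. by move=> gP hP i j p p0; apply: differentiableM; [exact: gP|exact: hP]. Qed.

Definition extendable : {pred (Mred -> C)} :=
  [pred g | `[< exists2 gh, holomorphic gh & g = gh \o Delta >]].

Lemma extendable_subring : subring_closed extendable.
Proof.
split.
- by apply/asboolP; exists (cst 1); [exact: holomorphic_cst | exact: funext].
- move=> f g /asboolP[fh fP ->] /asboolP[gh gP ->]; apply/asboolP.
  by exists (fh - gh); [exact: holomorphicB | exact: funext].
- move=> f g /asboolP[fh fP ->] /asboolP[gh gP ->]; apply/asboolP.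
  by exists (fh * gh); [exact: holomorphicM | exact: funext].
Qed.

Lemma extendable_scaler : GRing.scaler_closed extendable.
Proof.
move=> c f /asboolP[fh fP ->]; apply/asboolP; exists (cst c * fh).
  by apply: holomorphicM; [exact: holomorphic_cst | exact: fP].
exact: funext.
Qed.

HB.instance Definition _ :=
  GRing.isSubringClosed.Build (Mred -> C) extendable extendable_subring.
HB.instance Definition _ :=
  GRing.isScaleClosed.Build C (Mred -> C) extendable extendable_scaler.

(* The algebra A(Mred), as a unital subalgebra of the functions on Mred. *)
Record Ared : Type := MkAred {
  Ared_fun :> Mred -> C;
  Ared_funP : Ared_fun \in extendable }.

HB.instance Definition _ := [isSub of Ared for Ared_fun].
HB.instance Definition _ := [Choice of Ared by <:].
HB.instance Definition _ :=
  GRing.SubChoice_isSubComPzRing.Build _ _ Ared (subringClosedP _).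
HB.instance Definition _ := [SubZmodule_isSubLmodule of Ared by <:].

(* The holomorphic extension of g (it is unique when 1 <= s <= n + 1). *)
Definition ext (g : Ared) : hatMred -> C :=
  get [set gh | holomorphic gh /\ (g : Mred -> C) = gh \o Delta].

Lemma extP (g : Ared) : holomorphic (ext g) /\ (g : Mred -> C) = ext g \o Delta.
Proof.
have /asboolP[gh ghP e] := Ared_funP g.
exact: (@getPex _ [set gh | holomorphic gh /\ (g : Mred -> C) = gh \o Delta]
  (ex_intro _ gh (conj ghP e))).
Qed.

(* Locally uniform convergence of the extensions: as hatMred is locally compact,
   this is uniform convergence on its compact subsets. *)
HB.instance Definition _ := Uniform.copy Ared
  (initial_topology (ext : Ared -> {family compact, hatMred -> C})).

End ReducedSpaces.

(* Main.v *)
Require Import Defs.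
From mathcomp Require Import all_boot all_order all_algebra.
From mathcomp Require Import generic_quotient complex ring lra.
From mathcomp Require Import all_classical all_reals all_analysis.
Import Order.TTheory GRing.Theory Num.Theory numFieldNormedType.Exports.
Import Normc.
Local Open Scope quotient_scope.
Local Open Scope ring_scope.
Local Open Scope classical_set_scope.
Local Open Scope complex_scope.
Set Implicit Arguments.
Unset Strict Implicit.
Unset Printing Implicit Defensive.

(**
The map [(xi, eta)] |-> [(xi, nu nu' eta)], with nu and nu' the two sign vectors,
is a biholomorphism from the complexified reduced space of signature s' to that of
signature s, so pulling back the holomorphic extensions is the isomorphism. That this
is compatible with the algebra operations rests on uniqueness of the extension: a
holomorphic G vanishing on the diagonal vanishes everywhere. Any point is the value at
z = i of a quadratic curve (xi(z), eta(z)) with conjugate coefficients which lies on the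
diagonal for small real z; the denominator along the curve is a polynomial in z, whose
finitely many roots are avoided by a path from 0 to i, and the one-variable identity
theorem along that path gives G = 0 at the point.

Since holomorphic means only complex differentiable, the identity theorem needs Goursat's
theorem. Contour integrals are replaced by Riemann sums on 3^k subdivisions of the sides of
a parallelogram, which are exact on affine functions and additive under trisection. This
gives |g(c)| <= 12 max |g| over the boundary of a rectangle centred at c. Applied to
f(w) / (w - a)^N with N -> oo it shows that f(c) = 0 as soon as f vanishes near a and at
every boundary point w of the rectangle with |w - a| < r, for some r > |c - a|.
*)

(** * Complex absolute value and derivatives *)

Section ComplexNorm.
Variable R : realType.
Local Notation C := R[i].
Implicit Types (z w p u v : C) (f g : C -> C).

Lemma normr_normc z : `|z| = (normc z)%:C.
Proof. by []. Qed.

(* The library states these two for [Rcomplex R], whose operations do not match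
   those of [R[i]] syntactically. *)
Lemma normcD z w : normc (z + w) <= normc z + normc w.
Proof. exact: le_normcD. Qed.

Lemma normc_opp z : normc (- z) = normc z.
Proof. exact: normcN. Qed.

Lemma normc_zero : normc (0 : C) = 0.
Proof. exact: normc0. Qed.

Lemma normc_ge0 z : 0 <= normc z.
Proof. by rewrite -lecR -normr_normc normr_ge0. Qed.

Lemma normc_eq0 z : (normc z == 0) = (z == 0).
Proof. by apply/eqP/eqP => [/eq0_normc|->]; rewrite ?normc_zero. Qed.

Lemma normc_gt0 z : (0 < normc z) = (z != 0).
Proof. by rewrite lt_def normc_ge0 andbT normc_eq0. Qed.

Lemma normcX z k : normc (z ^+ k) = normc z ^+ k.
Proof. by elim: k => [|k IH]; rewrite ?expr0 ?normc1 ?expr0// !exprS normcM IH. Qed.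

Lemma normc_real (x : R) : normc x%:C = `|x|.
Proof. by rewrite /normc/= expr0n/= addr0 sqrtr_sqr. Qed.

Lemma ball_normc p (e : R) z : ball p e%:C z = (normc (z - p) < e) :> Prop.
Proof.
have -> : ball p e%:C z = (`|p - z| < e%:C) :> Prop by rewrite -ball_normE.
by rewrite -opprB normrN normr_normc ltcR.
Qed.

(** Radii of balls in [C] are themselves complex numbers; positivity forces them to be real, so real
    radii suffice. *)
Lemma nearP p (P : C -> Prop) :
  (\forall z \near p, P z) <->
  exists2 e : R, 0 < e & forall z, normc (z - p) < e -> P z.
Proof.
split=> [/nbhs_ballP[e /= e0 H]|[e e0 H]].
  have eE : e = (complex.Re e)%:C by rewrite RRe_real// gtr0_real.
  exists (complex.Re e); first by rewrite -ltcR -eE.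
  by move=> z ze; apply: H; rewrite eE ball_normc.
apply/nbhs_ballP; exists e%:C; first by rewrite /= ltcR.
by move=> z; rewrite ball_normc; exact: H.
Qed.

(** Multiplying the difference quotient by [w - p] removes the division, so the estimate also covers
    [w = p]. Goursat's local step uses it in this form. *)
Lemma derivable_normcP f p : derivable f p 1 ->
  exists d, forall e : R, 0 < e -> exists2 r : R, 0 < r &
    forall w, normc (w - p) < r ->
      normc (f w - f p - d * (w - p)) <= e * normc (w - p).
Proof.
move=> /cvg_ex[/= d /cvgrPdist_lt H]; exists d => e e0.
have /H/= : 0 < e%:C by rewrite ltcR.
rewrite /prop_near1 /dnbhs /within /= => /(nearP 0 _)[r r0 K]; exists r => // w wr.
have [->|wp] := eqVneq w p; first by rewrite !subrr mulr0 subrr normc_zero mulr0.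
have := K (w - p); rewrite subr0 subr_eq0 => /(_ wr wp).
rewrite normr_normc ltcR => /ltW.
have -> : (w - p) *: 1 + p = w by rewrite /GRing.scale/= mulr1 subrK.
move=> h; have wp0 : 0 < normc (w - p) by rewrite normc_gt0 subr_eq0.
have -> : f w - f p - d * (w - p) =
   - ((d - (w - p)^-1 *: (f w - f p)) * (w - p)).
  rewrite /GRing.scale/=; field; by rewrite subr_eq0.
by rewrite normc_opp normcM ler_pM2r.
Qed.

Lemma derivable_continuous f p : derivable f p 1 -> {for p, continuous f}.
Proof. by move/derivable1_diffP/differentiable_continuous. Qed.

Lemma continuous_normcP f p : {for p, continuous f} ->
  forall e : R, 0 < e -> exists2 r : R, 0 < r &
    forall w, normc (w - p) < r -> normc (f w - f p) < e.
Proof.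
move=> /cvgrPdist_lt H e e0; have /H : 0 < e%:C by rewrite ltcR.
move=> /nearP[r r0 K]; exists r => // w /K.
by rewrite -normrN opprB normr_normc ltcR.
Qed.

End ComplexNorm.

(** * Goursat's theorem *)

Section TriadicSubdivision.
Variable R : realType.

(** The intervals of length [3^-1 ^+ n] starting at [s n] are nested, and the supremum of their left
    ends lies in all of them. *)
Lemma nested_point (s : nat -> R) :
  (forall n, s n <= s n.+1 /\ s n.+1 + 3^-1 ^+ n.+1 <= s n + 3^-1 ^+ n) ->
  exists S, forall n, s n <= S <= s n + 3^-1 ^+ n.
Proof.
move=> H.
have mono m n : (m <= n)%N -> s m <= s n /\ s n + 3^-1 ^+ n <= s m + 3^-1 ^+ m.
  elim: n => [|n IH]; first by rewrite leqn0 => /eqP->.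
  rewrite leq_eqVlt => /orP[/eqP->//|]; rewrite ltnS => /IH[a b].
  by have [c d] := H n; split; [exact: le_trans c | exact: le_trans b].
have ub m n : s n <= s m + 3^-1 ^+ m.
  have p k : 0 <= 3^-1 ^+ k :> R by rewrite exprn_ge0// invr_ge0.
  have [/mono[a _]|/ltnW /mono[_ b]] := leqP n m.
    by rewrite (le_trans a)// lerDl.
  by rewrite (le_trans _ b)// lerDl.
exists (sup (range s)) => m; apply/andP; split.
  by apply: ub_le_sup; [exists (s m + 3^-1 ^+ m) => _ [n _ <-]; exact: ub | exists m].
by apply: ge_sup; [exists (s 0%N), 0%N | move=> _ [n _ <-]; exact: ub].
Qed.

(** If [P] fails on the unit square, it fails on one of its nine subsquares, then on a ninth of that
    one, and so on. These squares shrink to a point [(S, T)], where the local hypothesis is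
    contradicted. *)
Lemma triadic_induction (P : R -> R -> nat -> Prop) :
  (forall s t n, (forall a b, (a < 3)%N -> (b < 3)%N ->
     P (s + a%:R * 3^-1 ^+ n.+1) (t + b%:R * 3^-1 ^+ n.+1) n.+1) -> P s t n) ->
  (forall S T, 0 <= S <= 1 -> 0 <= T <= 1 -> exists m, forall s t n, (m <= n)%N ->
     s <= S <= s + 3^-1 ^+ n -> t <= T <= t + 3^-1 ^+ n -> P s t n) ->
  P 0 0 0%N.
Proof.
move=> step loc; apply: contrapT => nP.
pose good (p : R * R) n (q : R * R) :=
  exists a b, [/\ (a < 3)%N, (b < 3)%N, q.1 = p.1 + a%:R * 3^-1 ^+ n.+1,
    q.2 = p.2 + b%:R * 3^-1 ^+ n.+1 & ~ P q.1 q.2 n.+1].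
(* [x n] is the lower left corner of a square of side [3^-1 ^+ n] on which [P] fails. The default of
   [xget] is never taken, as [bad] shows. *)
pose x := fix x n := if n is m.+1 then xget (x m) (good (x m) m) else (0, 0).
have bad n : ~ P (x n).1 (x n).2 n /\ good (x n) n (x n.+1).
  elim: n => [|n [_ [a [b [_ _ _ _ IH]]]]].
    split=> //=; apply: xgetPex; apply: contrapT => ng; apply: nP; apply: step.
    move=> a b a3 b3; apply: contrapT => nQ; apply: ng.
    by exists (0 + a%:R * 3^-1 ^+ 1, 0 + b%:R * 3^-1 ^+ 1), a, b.
  split=> //=; apply: xgetPex; apply: contrapT => ng; apply: IH; apply: step.
  move=> c d c3 d3; apply: contrapT => nQ; apply: ng.
  by exists ((x n.+1).1 + c%:R * 3^-1 ^+ n.+2, (x n.+1).2 + d%:R * 3^-1 ^+ n.+2), c, d.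
have sub (s s' : R) n a : (a < 3)%N -> s' = s + a%:R * 3^-1 ^+ n.+1 ->
    s <= s' /\ s' + 3^-1 ^+ n.+1 <= s + 3^-1 ^+ n.
  move=> a3 ->; have p : 0 <= 3^-1 ^+ n.+1 :> R by rewrite exprn_ge0// invr_ge0.
  split; first by rewrite lerDl mulr_ge0.
  rewrite -addrA lerD2l -{2}[3^-1 ^+ n.+1]mul1r -mulrDl.
  have -> : 3^-1 ^+ n = 3 * 3^-1 ^+ n.+1 :> R by rewrite exprS; field.
  by rewrite ler_pM2r ?exprn_gt0 ?invr_gt0// natr1 ler_nat.
have [S HS] : exists S, forall n, (x n).1 <= S <= (x n).1 + 3^-1 ^+ n.
  apply: (@nested_point (fun n => (x n).1)) => n.
  by have [_ [a [b [a3 b3 e1 e2 _]]]] := bad n; exact: sub e1.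
have [T HT] : exists T, forall n, (x n).2 <= T <= (x n).2 + 3^-1 ^+ n.
  apply: (@nested_point (fun n => (x n).2)) => n.
  by have [_ [a [b [a3 b3 e1 e2 _]]]] := bad n; exact: sub e2.
have := HS 0%N; have := HT 0%N; rewrite /= expr0 add0r => T01 S01.
have [m] := loc _ _ S01 T01.
move=> /(_ _ _ _ (leqnn m) (HS m) (HT m)); exact: (bad m).1.
Qed.

End TriadicSubdivision.

(** * Riemann sums over segments and parallelograms *)

Section Contour.
Variable R : realType.
Local Notation C := R[i].
Implicit Types (z w p u v c : C) (f g : C -> C).

(* The midpoint Riemann sum of f over the segment [z, z + u] divided into
   3 ^ k equal parts. *)
Fixpoint edge f z u k : C :=
  if k is k'.+1 then
    edge f z (u / 3) k' + edge f (z + u / 3) (u / 3) k' +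
    edge f (z + u / 3 + u / 3) (u / 3) k'
  else u * f (z + u / 2).

Lemma edge_subM f g (a : C) z u k :
  edge (fun w => f w - a * g w) z u k = edge f z u k - a * edge g z u k.
Proof. by elim: k z u => [|k IH] z u /=; rewrite ?IH; ring. Qed.

(** The midpoint values over the three thirds average to the value at the midpoint of the whole
    segment, so subdividing changes nothing. *)
Lemma edge_affine (a b : C) z u k :
  edge (fun w => a + b * w) z u k = u * (a + b * (z + u / 2)).
Proof. by elim: k z u => [|k IH] z u /=; rewrite ?IH; field. Qed.

Lemma segment_third (P : C -> Prop) z u (n : nat) : (n < 3)%N ->
  (forall s : R, 0 <= s <= 1 -> P (z + s%:C * u)) ->
  forall s : R, 0 <= s <= 1 -> P (z + n%:R * (u / 3) + s%:C * (u / 3)).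
Proof.
move=> n3 H s /andP[s0 s1].
have -> : z + n%:R * (u / 3) + s%:C * (u / 3) = z + ((n%:R + s) / 3)%:C * u.
  by rewrite !(rmorphM, rmorphD, fmorphV, rmorph_nat)/=; field.
apply: H; rewrite divr_ge0 ?addr_ge0//= ler_pdivrMr// mul1r.
have : (n%:R <= 2 :> R) by rewrite ler_nat.
lra.
Qed.

Lemma edge_norm_le f z u k (B : R) :
  (forall s : R, 0 <= s <= 1 -> normc (f (z + s%:C * u)) <= B) ->
  normc (edge f z u k) <= normc u * B.
Proof.
elim: k z u => [|k IH] z u H /=.
  rewrite normcM ler_wpM2l ?normc_ge0//.
  have := H 2^-1; rewrite fmorphV rmorph_nat mulrC; apply; lra.
have K n n3 := IH _ _ (segment_third (P := fun w => normc (f w) <= B) (n := n) n3 H).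
have := K 0%N isT; have := K 1%N isT; have := K 2 isT.
have -> : z + 2 * (u / 3) = z + u / 3 + u / 3 by ring.
rewrite mul0r mul1r addr0.
rewrite normcM normcV.
have -> : normc (3 : C) = 3.
  have -> : (3 : C) = (3 : R)%:C by rewrite rmorph_nat.
  by rewrite normc_real ger0_norm.
set x := edge _ _ _ _; set y := edge _ _ _ _; set t := edge _ _ _ _.
have := normcD (t + y) x; have := normcD t y.
lra.
Qed.

(** Serves to bound the contour sum of [1 / (w - c)] away from 0; there [a] is 1 or -1, according to
    the direction in which the side is traversed. *)
Lemma edge_Im_ge f (a : C) z u k (b : R) :
  (forall s : R, 0 <= s <= 1 -> b <= complex.Im (a * (u * f (z + s%:C * u)))) ->
  b <= complex.Im (a * edge f z u k).
Proof.
elim: k z u b => [|k IH] z u b H /=.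
  have := H 2^-1; rewrite fmorphV rmorph_nat [2^-1 * u]mulrC; apply; lra.
have H3 s : 0 <= s <= 1 -> b / 3 <= complex.Im (a * (u / 3 * f (z + s%:C * u))).
  move=> /H; have -> : a * (u / 3 * f (z + s%:C * u)) =
      (3^-1)%:C * (a * (u * f (z + s%:C * u))).
    by rewrite fmorphV rmorph_nat; ring.
  case: (a * _) => x y /=; lra.
have K n n3 := IH _ _ _
  (segment_third (P := fun w => b / 3 <= complex.Im (a * (u / 3 * f w))) (n := n) n3 H3).
have := K 0%N isT; have := K 1%N isT; have := K 2 isT.
have -> : z + 2 * (u / 3) = z + u / 3 + u / 3 by ring.
rewrite mul0r mul1r addr0 !mulrDr !raddfD /=.
lra.
Qed.

(** Sides traversed backwards are subtracted instead of being summed along [- u] or [- v], so that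
    adjacent parallelograms share literally the same Riemann sum. *)
Definition contour f z u v k : C :=
  edge f z u k + edge f (z + u) v k - edge f (z + v) u k - edge f z v k.

Lemma contour_subM f g (a : C) z u v k :
  contour (fun w => f w - a * g w) z u v k = contour f z u v k - a * contour g z u v k.
Proof. by rewrite /contour !edge_subM; ring. Qed.

Lemma contour_affine (a b : C) z u v k : contour (fun w => a + b * w) z u v k = 0.
Proof. by rewrite /contour !edge_affine; field. Qed.

Lemma contour_norm_le f z u v k (B : R) :
  (forall s : R, 0 <= s <= 1 -> [/\ normc (f (z + s%:C * u)) <= B,
     normc (f (z + u + s%:C * v)) <= B, normc (f (z + v + s%:C * u)) <= B
     & normc (f (z + s%:C * v)) <= B]) ->
  normc (contour f z u v k) <= 2 * (normc u + normc v) * B.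
Proof.
move=> H; rewrite /contour.
have := @edge_norm_le f z u k B (fun s s1 => let: And4 h _ _ _ := H s s1 in h).
have := @edge_norm_le f (z + u) v k B (fun s s1 => let: And4 _ h _ _ := H s s1 in h).
have := @edge_norm_le f (z + v) u k B (fun s s1 => let: And4 _ _ h _ := H s s1 in h).
have := @edge_norm_le f z v k B (fun s s1 => let: And4 _ _ _ h := H s s1 in h).
set a := edge _ _ _ _; set b := edge _ _ _ _; set c := edge _ _ _ _; set d := edge _ _ _ _.
have := normcD (d + c - b) (- a); have := normcD (d + c) (- b); have := normcD d c.
rewrite !normc_opp; lra.
Qed.

(** Each inner side of the 3 by 3 grid occurs in two pieces with opposite signs and cancels; three
    outer sides at level [k] make up one side at level [k.+1]. *)
Lemma contour_split f z u v k :
  contour f z u v k.+1 =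
  \sum_(a < 3) \sum_(b < 3)
    contour f (z + a%:R * (u / 3) + b%:R * (v / 3)) (u / 3) (v / 3) k.
Proof.
(* [h a b] and [w a b] are the sums along [u / 3] and [v / 3] from the grid point [(a, b)]. *)
pose h (a b : nat) := edge f (z + a%:R * (u / 3) + b%:R * (v / 3)) (u / 3) k.
pose w (a b : nat) := edge f (z + a%:R * (u / 3) + b%:R * (v / 3)) (v / 3) k.
have E (a b : nat) : contour f (z + a%:R * (u / 3) + b%:R * (v / 3)) (u / 3) (v / 3) k =
    h a b + w a.+1 b - h a b.+1 - w a b.
  by rewrite /contour /h /w -!natr1; congr (_ + edge f _ _ _ - edge f _ _ _ - _); ring.
under eq_bigr do under eq_bigr do rewrite E.
have -> : contour f z u v k.+1 = h 0 0 + h 1 0 + h 2 0 + (w 3 0 + w 3 1 + w 3 2)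
    - (h 0 3 + h 1 3 + h 2 3) - (w 0 0 + w 0 1 + w 0 2).
  by rewrite /contour /h /w /=; congr (_ + _ + _ + (_ + _ + _) - (_ + _ + _) - (_ + _ + _));
    congr (edge f _ _ _); field.
by rewrite !big_ord_recl !big_ord0 /bump /= ?addn0 ?add1n; ring.
Qed.
End Contour.

(** * Goursat's theorem, also with a bounded singularity at the centre *)

Section Goursat.
Variable R : realType.
Local Notation C := R[i].
Implicit Types (z w p u v c : C) (f g : C -> C).

Lemma normc_nat n : normc (n%:R : C) = n%:R.
Proof. by rewrite -(rmorph_nat (real_complex R)) normc_real normr_nat. Qed.

Lemma normc_sum (I : Type) (r : seq I) (F : I -> C) :
  normc (\sum_(i <- r) F i) <= \sum_(i <- r) normc (F i).
Proof.
elim/big_ind2: _ => [|x a y b xa yb|//]; first by rewrite normc_zero.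
by rewrite (le_trans (normcD _ _))// lerD.
Qed.

Lemma exp3_gt (x : R) : exists n, x < 3 ^+ n.
Proof.
exists (Num.bound `|x|); apply: (le_lt_trans (ler_norm x)).
apply: (lt_trans (archi_boundP (normr_ge0 x))).
by rewrite -(natrX R 3) ltr_nat ltn_expl.
Qed.

Lemma contour_split_le f z u v (M : nat -> nat -> R) :
  (forall a b, (a < 3)%N -> (b < 3)%N -> exists K, forall k, (K <= k)%N ->
    normc (contour f (z + a%:R * (u / 3) + b%:R * (v / 3)) (u / 3) (v / 3) k) <= M a b) ->
  exists K, forall k, (K <= k)%N ->
    normc (contour f z u v k) <= \sum_(a < 3) \sum_(b < 3) M a b.
Proof.
move=> H.
have {}H (ab : 'I_3 * 'I_3) := H ab.1 ab.2 (ltn_ord _) (ltn_ord _).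
have [K HK] := choice H.
(* The successor accounts for the level of subdivision spent on the split. *)
exists (\max_ab K ab).+1 => -[//|k]; rewrite ltnS => leKk.
rewrite contour_split (le_trans (normc_sum _ _))// ler_sum// => a _.
rewrite (le_trans (normc_sum _ _))// ler_sum// => b _.
by apply: (HK (a, b)); apply: leq_trans leKk; exact: leq_bigmax.
Qed.

(** The claim for a piece of scale [q n] allows an error [e * q n ^+ 2], proportional to its area,
    so the errors of nine pieces add up to that of their union. Near a point of differentiability
    [f] is affine up to a small multiple of the distance, and affine functions have contour sum
    0. *)
Theorem goursat f z u v :
  (forall s t : R, 0 <= s <= 1 -> 0 <= t <= 1 ->
    derivable f (z + s%:C * u + t%:C * v) 1) ->
  forall e : R, 0 < e -> exists K, forall k, (K <= k)%N ->
    normc (contour f z u v k) <= e.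
Proof.
move=> df e e0.
pose q n : R := 3^-1 ^+ n.
have q0 n : 0 < q n by rewrite exprn_gt0// invr_gt0.
have qS n : q n.+1 = q n / 3 by rewrite /q exprSr.
pose P (s t : R) n := exists K, forall k, (K <= k)%N ->
  normc (contour f (z + s%:C * u + t%:C * v) ((q n)%:C * u) ((q n)%:C * v) k)
    <= e * q n ^+ 2.
suff : P 0 0 0%N.
  by rewrite /P/= !mul0r !addr0 /q expr0 expr1n mulr1 !mul1r.
apply: triadic_induction => [s t n H|S T S01 T01].
  rewrite /P; have -> : e * q n ^+ 2 = \sum_(a < 3) \sum_(b < 3) (e * q n.+1 ^+ 2).
    by rewrite !sumr_const !card_ord qS; field.
  apply: (@contour_split_le _ _ _ _ (fun _ _ => e * q n.+1 ^+ 2)) => a b a3 b3.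
  have [K HK] := H a b a3 b3; exists K => k /HK.
  rewrite -!/(q _); congr (normc (contour _ _ _ _ _) <= _);
    rewrite qS !(rmorphD, rmorphM, fmorphV, rmorph_nat)/=; ring.
set p := z + S%:C * u + T%:C * v.
have [d Hd] := derivable_normcP (df S T S01 T01).
set L := normc u + normc v; have L0 : 0 <= L by rewrite addr_ge0 ?normc_ge0.
(* On a piece of scale [q n] the perimeter is [2 * q n * L] and the deviation from the affine part
   at most [h * q n * L], so [2 * L ^+ 2 * h <= e] is what is required. The summand 1 covers
   [L = 0]. *)
pose h := e / (2 * L ^+ 2 + 1).
have h0 : 0 < h by rewrite divr_gt0// ltr_wpDl// mulr_ge0// exprn_ge0.
have [r r0 Hr] := Hd h h0.
have [m Hm] := exp3_gt (L / r).
exists m => s t n mn /andP[sS Ss] /andP[tT Tt]; exists 0%N => k _.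
have near_p (x y : R) : s <= x <= s + q n -> t <= y <= t + q n ->
    normc (z + x%:C * u + y%:C * v - p) <= q n * L.
  move=> x1 y1; have -> : z + x%:C * u + y%:C * v - p = (x - S)%:C * u + (y - T)%:C * v.
    by rewrite /p !rmorphB/=; ring.
  rewrite (le_trans (normcD _ _))// !normcM !normc_real mulrDr.
  have sq : 0 <= s + q n - S by rewrite subr_ge0.
  have tq : 0 <= t + q n - T by rewrite subr_ge0.
  rewrite lerD// ler_wpM2r ?normc_ge0// ler_norml; apply/andP; split;
   move: x1 y1 sq tq => /andP[? ?] /andP[? ?]; lra.
have qLr : q n * L < r.
  have : q n <= q m.
    by rewrite /q ler_wiXn2l// ?invr_ge0// invf_le1 ?ler1n.
  have : q m * L < r.
    by rewrite /q exprVn mulrC ltr_pdivrMr ?exprn_gt0// -ltr_pdivrMl// mulrC.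
  move=> a b; apply: le_lt_trans a; exact: ler_wpM2r.
have affine_err (x y : R) : s <= x <= s + q n -> t <= y <= t + q n ->
    normc (f (z + x%:C * u + y%:C * v) - 1 *
       ((f p - d * p) + d * (z + x%:C * u + y%:C * v))) <= h * (q n * L).
  move=> x1 y1; set w := _ + _ * v.
  have -> : f w - 1 * ((f p - d * p) + d * w) = f w - f p - d * (w - p) by ring.
  have wp := near_p _ _ x1 y1.
  by rewrite (le_trans (Hr w (le_lt_trans wp qLr)))// ler_wpM2l// ltW.
set Z := z + _ + _; set U := _ * u; set V := _ * v.
have -> : contour f Z U V k =
    contour (fun w => f w - 1 * ((f p - d * p) + d * w)) Z U V k.
  by rewrite contour_subM contour_affine mulr0 subr0.
have qn0 := q0 n.
apply: le_trans (@contour_norm_le _ _ _ _ _ _ (h * (q n * L)) _) _.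
  move=> x /andP[x0 x1].
  have xq : x * q n <= q n by apply: ler_piMl => //; exact: ltW.
  have xq0 : 0 <= x * q n by apply: mulr_ge0 => //; exact: ltW.
  have Sx : s <= s + x * q n <= s + q n by apply/andP; split; lra.
  have Tx : t <= t + x * q n <= t + q n by apply/andP; split; lra.
  have S0 : s <= s <= s + q n by apply/andP; split; lra.
  have S1 : s <= s + q n <= s + q n by apply/andP; split; lra.
  have T0 : t <= t <= t + q n by apply/andP; split; lra.
  have T1 : t <= t + q n <= t + q n by apply/andP; split; lra.
  split.
  - have -> : Z + x%:C * U = z + (s + x * q n)%:C * u + t%:C * v.
      by rewrite /Z /U rmorphD rmorphM/=; ring.
    exact: affine_err.
  - have -> : Z + U + x%:C * V = z + (s + q n)%:C * u + (t + x * q n)%:C * v.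
      by rewrite /Z /U /V !rmorphD rmorphM/=; ring.
    exact: affine_err.
  - have -> : Z + V + x%:C * U = z + (s + x * q n)%:C * u + (t + q n)%:C * v.
      by rewrite /Z /U /V !rmorphD rmorphM/=; ring.
    exact: affine_err.
  - have -> : Z + x%:C * V = z + s%:C * u + (t + x * q n)%:C * v.
      by rewrite /Z /U /V !rmorphD rmorphM/=; ring.
    exact: affine_err.
rewrite /U /V !normcM !normc_real (ger0_norm (ltW qn0)) -mulrDr -/L.
have -> : 2 * (q n * L) * (h * (q n * L)) = (2 * L ^+ 2 * h) * q n ^+ 2 by ring.
rewrite ler_wpM2r ?exprn_ge0 ?ltW// /h mulrA ltr_pdivrMr; last first.
  by rewrite ltr_wpDl// mulr_ge0// exprn_ge0.
by rewrite mulrDr mulr1 mulrC ltrDl.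
Qed.

(* At the n-th trisection only the central parallelogram contains the singularity c,
   and there the contour sum is at most B times a perimeter of order 3 ^- n. *)
Lemma goursat_center f c (r B : R) n u v : 0 < r -> 0 <= B ->
  (forall w, normc (w - c) < r -> normc (f w) <= B) ->
  (forall s t : R, s%:C * u + t%:C * v = 0 -> s = 0 /\ t = 0) ->
  (forall s t : R, 0 <= s <= 1 -> 0 <= t <= 1 ->
    c - (u + v) / 2 + s%:C * u + t%:C * v != c ->
    derivable f (c - (u + v) / 2 + s%:C * u + t%:C * v) 1) ->
  normc u + normc v < 3 ^+ n * r ->
  forall e : R, 0 < e -> exists K, forall k, (K <= k)%N ->
    normc (contour f (c - (u + v) / 2) u v k)
      <= 2 * (normc u + normc v) * B / 3 ^+ n + e.
Proof.
move=> r0 B0 fB; elim: n u v => [|n IH] u v indep df uvr e e0.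
  (* With no trisection left the whole parallelogram lies in the disc where [f] is bounded by [B],
     and the perimeter estimate suffices. *)
  exists 0%N => k _; rewrite expr0 divr1 -[leLHS]addr0 lerD// ?(ltW e0)//.
  have near_c (x y : R) : 0 <= x <= 1 -> 0 <= y <= 1 ->
      normc (f (c - (u + v) / 2 + x%:C * u + y%:C * v)) <= B.
    move=> x01 y01; apply: fB; rewrite expr0 mul1r in uvr; apply: le_lt_trans uvr.
    have -> : c - (u + v) / 2 + x%:C * u + y%:C * v - c =
        (x - 2^-1)%:C * u + (y - 2^-1)%:C * v.
      by rewrite !rmorphB/= fmorphV rmorph_nat; field.
    rewrite (le_trans (normcD _ _))// !normcM !normc_real lerD// ler_piMl ?normc_ge0//;
      rewrite ler_norml; lra.
  have I0 : 0 <= (0 : R) <= 1 by rewrite lexx ler01.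
  have I1 : 0 <= (1 : R) <= 1 by rewrite lexx ler01.
  apply: contour_norm_le => s s01; split.
  - by have := near_c s 0 s01 I0; rewrite mul0r addr0.
  - by have := near_c 1 s I1 s01; rewrite mul1r.
  - by have := near_c s 1 s01 I1; rewrite mul1r addrAC.
  - by have := near_c 0 s I0 s01; rewrite mul0r addr0.
have n3 (w : C) : normc (w / 3) = normc w / 3 by rewrite normcM normcV normc_nat.
(* The error [e] is shared equally among the nine pieces; the central one also carries the inductive
   bound, whose perimeter has shrunk by 3. *)
pose M (a b : nat) :=
  if (a == 1%N) && (b == 1%N) then 2 * (normc u + normc v) * B / 3 ^+ n.+1 + e / 9 else e / 9.
have p0 : (3 ^+ n : R) != 0 by rewrite expf_neq0.
have -> : 2 * (normc u + normc v) * B / 3 ^+ n.+1 + e = \sum_(a < 3) \sum_(b < 3) M a b.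
  by rewrite !big_ord_recl !big_ord0 /M /= exprS; field.
apply: contour_split_le => a b a3 b3.
have e9 : 0 < e / 9 by rewrite divr_gt0.
set Z := c - _ + _ + _.
have ZE (s t : R) : Z + s%:C * (u / 3) + t%:C * (v / 3) =
    c - (u + v) / 2 + ((a%:R + s) / 3)%:C * u + ((b%:R + t) / 3)%:C * v.
  by rewrite /Z !(rmorphM, rmorphD, fmorphV, rmorph_nat)/=; field.
have third k (x : R) : (k < 3)%N -> 0 <= x <= 1 -> 0 <= (k%:R + x) / 3 <= 1.
  move=> k3 /andP[x0 x1]; rewrite divr_ge0 ?addr_ge0//= ler_pdivrMr// mul1r.
  have : (k%:R <= 2 :> R) by rewrite ler_nat.
  lra.
rewrite /M; case: ifP => [/andP[/eqP a1 /eqP b1]|ab].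
  have -> : Z = c - (u / 3 + v / 3) / 2 by rewrite /Z a1 b1; field.
  have -> : 2 * (normc u + normc v) * B / 3 ^+ n.+1 =
      2 * (normc (u / 3) + normc (v / 3)) * B / 3 ^+ n.
    by rewrite !n3 exprS; field.
  apply: IH => //.
  - move=> s t st0; apply: indep.
    by have := congr1 ( *%R 3) st0; rewrite mulr0 => <-; field.
  - move=> s t s01 t01.
    have -> : c - (u / 3 + v / 3) / 2 = Z by rewrite /Z a1 b1; field.
    by rewrite ZE; apply: df; exact: third.
  - by move: uvr; rewrite !n3 exprS; lra.
apply: goursat => // s t s01 t01; rewrite ZE; apply: df; try exact: third.
(* A piece containing [c] would, by independence of [u] and [v], have both grid coordinates of [c]
   equal to 1/2, which forces [a = b = 1]. *)
apply/eqP => E.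
have [] := indep ((a%:R + s) / 3 - 2^-1) ((b%:R + t) / 3 - 2^-1).
  have <- : c - (u + v) / 2 + ((a%:R + s) / 3)%:C * u + ((b%:R + t) / 3)%:C * v - c =
      ((a%:R + s) / 3 - 2^-1)%:C * u + ((b%:R + t) / 3 - 2^-1)%:C * v.
    by rewrite !rmorphB/= fmorphV rmorph_nat; field.
  by rewrite E subrr.
case/andP: s01 t01 => s0 s1 /andP[t0 t1] es et.
have odd1 k (x : R) : (k < 3)%N -> 0 <= x -> x <= 1 -> (k%:R + x) / 3 - 2^-1 = 0 -> k = 1%N.
  by case: k => [|[|[|//]]] //= _ x0 x1 E0; exfalso; lra.
by rewrite (odd1 a s) // (odd1 b t) in ab.
Qed.

Lemma goursat_bounded_center f c (r B : R) u v : 0 < r -> 0 <= B ->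
  (forall w, normc (w - c) < r -> normc (f w) <= B) ->
  (forall s t : R, s%:C * u + t%:C * v = 0 -> s = 0 /\ t = 0) ->
  (forall s t : R, 0 <= s <= 1 -> 0 <= t <= 1 ->
    c - (u + v) / 2 + s%:C * u + t%:C * v != c ->
    derivable f (c - (u + v) / 2 + s%:C * u + t%:C * v) 1) ->
  forall e : R, 0 < e -> exists K, forall k, (K <= k)%N ->
    normc (contour f (c - (u + v) / 2) u v k) <= e.
Proof.
move=> r0 B0 fB indep df e e0.
have e2 : 0 < e / 2 by rewrite divr_gt0.
set L := normc u + normc v; have L0 : 0 <= L by rewrite addr_ge0 ?normc_ge0.
(* The sum of two thresholds lets one [n] bring the central piece into the disc of radius [r] and
   push its contribution below [e / 2]. *)
have [n Hn] := exp3_gt (L / r + 2 * L * B / (e / 2)).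
have a0 : 0 <= L / r by rewrite divr_ge0// ltW.
have b0 : 0 <= 2 * L * B / (e / 2) by rewrite !mulr_ge0// invr_ge0 ltW.
have n0 : 0 < 3 ^+ n :> R by rewrite exprn_gt0.
have uvr : L < 3 ^+ n * r.
  by rewrite -ltr_pdivrMr// (le_lt_trans _ Hn)// lerDl.
have [K HK] := goursat_center r0 B0 fB indep df uvr e2.
exists K => k /HK h; apply: le_trans h _.
rewrite -/L [leRHS](splitr e) lerD2r ler_pdivrMr// [e / 2 * _]mulrC -ler_pdivrMr//.
by rewrite (le_trans _ (ltW Hn))// lerDr.
Qed.

End Goursat.

(** * The Cauchy bound and the identity theorem *)

Section CauchyBound.
Variable R : realType.
Local Notation C := R[i].
Implicit Types (z w p u v c : C) (f g : C -> C).

Lemma normc_ge_absRe w : `|complex.Re w| <= normc w.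
Proof. by rewrite -lecR -normr_normc normc_ge_Re. Qed.

Lemma normc_ge_absIm w : `|complex.Im w| <= normc w.
Proof.
case: w => a b /=; rewrite -sqrtr_sqr ler_wsqrtr// lerDr; exact: sqr_ge0.
Qed.

Lemma normc_le_ReIm w : normc w <= `|complex.Re w| + `|complex.Im w|.
Proof.
rewrite [w in leLHS]complexE (le_trans (normcD _ _))// normcM !normc_real.
by rewrite (_ : normc 'i = 1) ?mul1r//= expr0n/= add0r expr1n sqrtr1.
Qed.

Lemma invc_complex (a b : R) :
  (a +i* b)^-1 = (a / (a ^+ 2 + b ^+ 2)) +i* (- (b / (a ^+ 2 + b ^+ 2))).
Proof. by []. Qed.

(** The width is twice the height so that in [vanish_of_real] the lateral sides are farther than the
    centre from a point slightly below the lower side. *)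
Definition rect c (y : R) w : Prop :=
  `|complex.Re (w - c)| <= 2 * y /\ `|complex.Im (w - c)| <= y.

Definition rect_boundary c (y : R) w : Prop :=
  rect c y w /\ (`|complex.Re (w - c)| = 2 * y \/ `|complex.Im (w - c)| = y).

(** The quotient [(g w - g c) / (w - c)] is bounded near [c], so its contour sums become arbitrarily
    small. Hence [g c] times the sum of [1 / (w - c)], of modulus at least 1, is nearly the sum of
    [g w / (w - c)], which is at most the perimeter [12 * y] times [M / y]. *)
Lemma cauchy_bound c (y M : R) g : 0 < y ->
  (forall w, rect c y w -> derivable g w 1) ->
  (forall w, rect_boundary c y w -> normc (g w) <= M) ->
  normc (g c) <= 12 * M.
Proof.
move=> y0 dg gM.
pose u : C := (4 * y)%:C; pose v : C := 0 +i* (2 * y).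
have uv2 : (u + v) / 2 = (2 * y) +i* y.
  apply: (mulIf (_ : 2 != 0 :> C)) => //; rewrite divfK// mulr_natr mulr2n.
  by apply/eqP; rewrite eq_complex/=; apply/andP; split; apply/eqP; ring.
have zE (s t : R) : c - (u + v) / 2 + s%:C * u + t%:C * v =
    c + ((4 * s - 2) * y +i* ((2 * t - 1) * y)).
  rewrite uv2 -!addrA; congr (_ + _).
  by apply/eqP; rewrite eq_complex/=; apply/andP; split; apply/eqP; ring.
have inrect (s t : R) : 0 <= s <= 1 -> 0 <= t <= 1 ->
    rect c y (c - (u + v) / 2 + s%:C * u + t%:C * v).
  move=> s01 t01; rewrite zE /rect addrC addKr /= !normrM (gtr0_norm y0); split.
    by rewrite ler_pM2r// ler_norml; lra.
  by rewrite -[leRHS]mul1r ler_pM2r// ler_norml; lra.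
have e0 s : s = 0 \/ s = 1 -> `|4 * s - 2| = 2 :> R.
  by case=> ->; rewrite ?mulr0 ?mulr1 ?sub0r ?normrN; [|have -> : 4 - 2 = 2 :> R by ring];
    rewrite normr_nat.
have e1 t : t = 0 \/ t = 1 -> `|2 * t - 1| = 1 :> R.
  by case=> ->; rewrite ?mulr0 ?mulr1 ?sub0r ?normrN; [|have -> : 2 - 1 = 1 :> R by ring];
    rewrite normr1.
have I0 : 0 <= (0 : R) <= 1 by rewrite lexx ler01.
have I1 : 0 <= (1 : R) <= 1 by rewrite lexx ler01.
have onbd (s t : R) : 0 <= s <= 1 -> 0 <= t <= 1 ->
    (s = 0 \/ s = 1) \/ (t = 0 \/ t = 1) ->
    rect_boundary c y (c - (u + v) / 2 + s%:C * u + t%:C * v).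
  move=> s01 t01 st; split; first exact: inrect.
  rewrite zE addrC addKr /= !normrM (gtr0_norm y0).
  by case: st => [/e0->|/e1->]; [left|right; rewrite mul1r].
have bd_dist w : rect_boundary c y w -> y <= normc (w - c).
  move=> [_ [h|h]].
    by apply: le_trans (normc_ge_absRe _); rewrite h; lra.
  by apply: le_trans (normc_ge_absIm _); rewrite h.
pose inv w := (w - c)^-1.
pose q w := g w / (w - c).
pose h w := q w - g c * inv w.
have hE w : h w = (g w - g c) / (w - c) by rewrite /h /q /inv mulrBl.
have cc : rect c y c.
  by rewrite /rect subrr /= normr0; split; [rewrite mulr_ge0 ?ltW | exact: ltW].
have [d Hd] := derivable_normcP (dg _ cc).
have [r r0 Hr] := Hd 1 ltr01.
have hB w : normc (w - c) < r -> normc (h w) <= normc d + 1.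
  move=> wr; rewrite hE; have [->|wc] := eqVneq w c.
    by rewrite subrr mul0r normc_zero addr_ge0 ?normc_ge0.
  have wc0 : 0 < normc (w - c) by rewrite normc_gt0 subr_eq0.
  rewrite normcM normcV ler_pdivrMr// mulrDl mul1r.
  have -> : g w - g c = (g w - g c - d * (w - c)) + d * (w - c) by ring.
  rewrite (le_trans (normcD _ _))// addrC normcM lerD2l.
  by have := Hr w wr; rewrite mul1r.
have hd w : rect c y w -> w != c -> derivable h w 1.
  move=> wR wc.
  have di : derivable inv w 1.
    apply: (@derivableV C C (fun w => w - c)); first by rewrite subr_eq0.
    apply: derivableB; [exact: derivable_id | exact: derivable_cst].
  have -> : h = g * inv - cst (g c) * inv by exact/funext.
  have gw : derivable g w 1 by exact: dg.
  have cw : derivable (cst (g c) : C -> C) w 1 by exact: derivable_cst.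
  exact: derivableB (derivableM gw di) (derivableM cw di).
have indep (s t : R) : s%:C * u + t%:C * v = 0 -> s = 0 /\ t = 0.
  move=> [] /eqP + /eqP.
  rewrite !mul0r !mulr0 !subr0 !addr0 !add0r !mulf_eq0 !(gt_eqF y0) !pnatr_eq0 !orbF.
  by move=> /eqP-> /eqP->.
have normc_u : normc u = 4 * y by rewrite normc_real ger0_norm// mulr_ge0// ltW.
have nv : normc v = 2 * y.
  by rewrite /= expr0n/= add0r sqrtr_sqr ger0_norm// mulr_ge0// ltW.
have M0 : 0 <= M.
  by apply: le_trans (gM _ (onbd 0 0 I0 I0 (or_introl (or_introl erefl)))); exact: normc_ge0.
have qM w : rect_boundary c y w -> normc (q w) <= M / y.
  move=> wb; have wy := bd_dist w wb.
  rewrite normcM normcV; apply: ler_pM; rewrite ?normc_ge0 ?invr_ge0 ?normc_ge0//.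
    exact: gM.
  by rewrite lef_pV2// posrE//; apply: lt_le_trans wy.
set z := c - (u + v) / 2 in zE inrect onbd *.
have bd4 (s : R) : 0 <= s <= 1 -> [/\ rect_boundary c y (z + s%:C * u),
    rect_boundary c y (z + u + s%:C * v), rect_boundary c y (z + v + s%:C * u)
    & rect_boundary c y (z + s%:C * v)].
  move=> s01; split.
  - by have := onbd s 0 s01 I0 (or_intror (or_introl erefl)); rewrite mul0r addr0.
  - by have := onbd 1 s I1 s01 (or_introl (or_intror erefl)); rewrite mul1r.
  - by have := onbd s 1 s01 I1 (or_intror (or_intror erefl)); rewrite mul1r addrAC.
  - by have := onbd 0 s I0 s01 (or_introl (or_introl erefl)); rewrite mul0r addr0.
have contour_q k : normc (contour q z u v k) <= 12 * M.
  apply: le_trans (contour_norm_le (B := M / y) _ _) _.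
    by move=> s /bd4[a b c' d']; split; exact: qM.
  by rewrite normc_u nv le_eqVlt; apply/orP; left; apply/eqP; field; rewrite gt_eqF.
(* On each side, with its orientation, the imaginary part of the integrand is [4 * y ^+ 2] divided
   by the squared distance to [c], which is at most [5 * y ^+ 2]. The four sides thus give at least
   16/5. *)
have contour_inv k : 1 <= normc (contour inv z u v k).
  apply: le_trans (normc_ge_absIm _); apply: le_trans (ler_norm _).
  have aux (a b : R) : 0 < a ^+ 2 + b ^+ 2 <= 5 ->
      4 / 5 <= 4 * y ^+ 2 * ((a * y) ^+ 2 + (b * y) ^+ 2)^-1.
    move=> /andP[ab0 ab5]; rewrite !exprMn -mulrDl ler_pdivlMr ?mulr_gt0 ?exprn_gt0//.
    by rewrite mulrA ler_wpM2r ?exprn_ge0 ?(ltW y0)//; lra.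
  have sqr_le (t : R) : 0 <= t <= 1 -> 0 <= (2 * t - 1) ^+ 2 <= 1.
    by move=> ?; rewrite sqr_ge0/=; nra.
  have f1 : 4 / 5 <= complex.Im (1 * edge inv z u k).
    apply: edge_Im_ge => s s01.
    have := zE s 0; rewrite mul0r addr0 => E; rewrite /inv E addrC addKr invc_complex /=.
    apply: le_trans (aux (4 * s - 2) (2 * 0 - 1) _) _.
      by have := sqr_le s s01; have := sqr_ge0 (4 * s - 2); lra.
    by rewrite le_eqVlt; apply/orP; left; apply/eqP; set D := (_ + _)^-1; ring.
  have f2 : 4 / 5 <= complex.Im (1 * edge inv (z + u) v k).
    apply: edge_Im_ge => s s01.
    have := zE 1 s; rewrite [1%:C * u]mul1r => E; rewrite /inv E addrC addKr invc_complex /=.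
    apply: le_trans (aux (4 * 1 - 2) (2 * s - 1) _) _.
      by have := sqr_le s s01; lra.
    by rewrite le_eqVlt; apply/orP; left; apply/eqP; set D := (_ + _)^-1; ring.
  have f3 : 4 / 5 <= complex.Im (-1 * edge inv (z + v) u k).
    apply: edge_Im_ge => s s01.
    have := zE s 1; rewrite mul1r addrAC => E; rewrite /inv E addrC addKr invc_complex /=.
    apply: le_trans (aux (4 * s - 2) (2 * 1 - 1) _) _.
      by have := sqr_le s s01; have := sqr_ge0 (4 * s - 2); lra.
    by rewrite le_eqVlt; apply/orP; left; apply/eqP; set D := (_ + _)^-1; ring.
  have f4 : 4 / 5 <= complex.Im (-1 * edge inv z v k).
    apply: edge_Im_ge => s s01.
    have := zE 0 s; rewrite mul0r addr0 => E; rewrite /inv E addrC addKr invc_complex /=.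
    apply: le_trans (aux (4 * 0 - 2) (2 * s - 1) _) _.
      by have := sqr_le s s01; lra.
    by rewrite le_eqVlt; apply/orP; left; apply/eqP; set D := (_ + _)^-1; ring.
  move: f1 f2 f3 f4; rewrite /contour !mul1r !mulN1r.
  by rewrite !raddfN !raddfD !raddfN /=; lra.
apply/ler_addgt0Pr => e e_gt0.
have nd0 : 0 <= normc d + 1 by rewrite addr_ge0 ?normc_ge0.
have [K HK] := goursat_bounded_center r0 nd0 hB indep
  (fun s t s01 t01 => hd _ (inrect s t s01 t01)) e_gt0.
have := HK K (leqnn K); rewrite -/z contour_subM => hK.
have gE : g c * contour inv z u v K =
    contour q z u v K - (contour q z u v K - g c * contour inv z u v K) by ring.
have : normc (g c) <= normc (g c * contour inv z u v K).
  by rewrite normcM ler_peMr ?normc_ge0.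
move=> /le_trans; apply; rewrite gE (le_trans (normcD _ _))// normc_opp lerD//.
Qed.

End CauchyBound.

Section IdentityTheorem.
Variable R : realType.
Local Notation C := R[i].
Implicit Types (z w p u v c a : C) (f g : C -> C).

Lemma geometric_lt (A rho x : R) : 0 <= rho < 1 -> 0 < x -> exists N, A * rho ^+ N < x.
Proof.
move=> /andP[rho0 rho1] x0.
have : (fun n => A * rho ^+ n) @ \oo --> A * 0.
  by apply: cvgM; [exact: cvg_cst | apply: cvg_expr; rewrite ger0_norm].
rewrite mulr0 => /cvgrPdist_lt/(_ x x0)[N _ HN].
exists N; have := HN N (leqnn N); rewrite /= sub0r normrN.
exact/le_lt_trans/ler_norm.
Qed.

(** The Cauchy bound for [f w / (w - a) ^+ N.+1] gives [normc (f c) <= 12 * M * (normc (c - a) / r)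
    ^+ N.+1], which tends to 0. If [a] lies in the rectangle, the quotient is still derivable there
    because it vanishes near [a]. *)
Lemma vanish_of_far_boundary f a c (y M r : R) : 0 < y ->
  (forall w, rect c y w -> derivable f w 1) ->
  (forall w, rect c y w -> normc (f w) <= M) ->
  (rect c y a -> \forall w \near a, f w = 0) ->
  (forall w, rect_boundary c y w -> f w = 0 \/ r <= normc (w - a)) ->
  normc (c - a) < r -> f c = 0.
Proof.
move=> y0 df fM fa fb car.
have r0 : 0 < r by apply: le_lt_trans car; exact: normc_ge0.
have cc : rect c y c.
  by rewrite /rect subrr /= normr0; split; [rewrite mulr_ge0 ?ltW | exact: ltW].
have M0 : 0 <= M by apply: le_trans (fM _ cc); exact: normc_ge0.
have [ca|ca] := eqVneq c a.
  have aR : rect c y a by rewrite -[X in rect _ _ X]ca.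
  have [e e0 h] := (nearP _ _).1 (fa aR).
  by rewrite ca; apply: h; rewrite subrr normc_zero.
have ca0 : 0 < normc (c - a) by rewrite normc_gt0 subr_eq0.
have bound N : normc (f c) <= 12 * M * (normc (c - a) / r) ^+ N.+1.
  pose k : C -> C := fun w => (w - a)^-1.
  pose g : C -> C := f * k ^+ N.+1.
  have gE w : g w = f w * (w - a)^-1 ^+ N.+1.
    rewrite /g /=; congr (_ * _).
    by elim: N.+1 => [|n IH]; rewrite ?expr0// !exprS -IH.
  have : normc (g c) <= 12 * (M / r ^+ N.+1).
    apply: (@cauchy_bound _ c y _ g y0) => w wR.
      have [wa|wa] := eqVneq w a.
        rewrite {}wa in wR *; apply: (near_eq_derivable _ (derivable_cst (0 : C) _ _)).
        by apply: filterS (fa wR) => x fx; rewrite gE fx mul0r.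
      have dk : derivable k w 1.
        apply: (@derivableV C C (fun w => w - a)); first by rewrite subr_eq0.
        apply: derivableB; [exact: derivable_id | exact: derivable_cst].
      have dkN : derivable (k ^+ N.+1) w 1.
        exact: (@derivableX C C k N.+1 w 1 dk).
      exact: derivableM (df w wR) dkN.
    rewrite gE normcM normcX normcV; case: (fb w wR) => [->|rw].
      by rewrite normc_zero mul0r divr_ge0// exprn_ge0// ltW.
    rewrite -exprVn; apply: ler_pM; rewrite ?exprn_ge0 ?invr_ge0 ?normc_ge0//.
      by apply: fM; case: wR.
    rewrite lerXn2r ?nnegrE ?invr_ge0 ?normc_ge0// ?(ltW r0)//.
    by rewrite lef_pV2// posrE//; apply: lt_le_trans rw.
  rewrite gE normcM normcX normcV exprVn ler_pdivrMr ?exprn_gt0//.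
  move=> /le_trans; apply; rewrite expr_div_n le_eqVlt; apply/orP; left; apply/eqP.
  by set x := _ ^+ N.+1; set q := _^-1; ring.
apply/eqP; rewrite -normc_eq0; apply/eqP/le_anti; rewrite normc_ge0 andbT leNgt.
apply/negP => fc0.
have q01 : 0 <= normc (c - a) / r < 1.
  by rewrite divr_ge0 ?normc_ge0 ?(ltW r0)//= ltr_pdivrMr// mul1r.
have [N] := geometric_lt (12 * M) q01 fc0.
apply/negP; rewrite -leNgt; apply: le_trans (bound N) _.
rewrite ler_wpM2l ?mulr_ge0//; case/andP: q01 => q0 q1.
by rewrite ler_wiXn2l// ltW.
Qed.

Lemma rect_normc c (y : R) w : rect c y w -> normc (w - c) <= 3 * y.
Proof. by move=> [h k]; have := normc_le_ReIm (w - c); lra. Qed.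

Lemma derivable_near_bounded f p : (\forall w \near p, derivable f w 1) ->
  exists M r : R, 0 < r /\
    forall w, normc (w - p) < r -> derivable f w 1 /\ normc (f w) <= M.
Proof.
move=> /nearP[r1 r10 H1].
have dp : derivable f p 1 by apply: H1; rewrite subrr normc_zero.
have [r2 r20 H2] := continuous_normcP (derivable_continuous dp) ltr01.
exists (normc (f p) + 1), (Num.min r1 r2); split; first by rewrite lt_min r10.
move=> w; rewrite lt_min => /andP[/H1 dw /H2 fw]; split=> //.
have -> : f w = f p + (f w - f p) by ring.
by rewrite (le_trans (normcD _ _))// lerD2l ltW.
Qed.

(** The radius depends on [p] and not on [a], which is what continuation along a path needs.
    Rectangles of one fixed size work: their boundary is at distance at least [y] from the centre
    [c], and [a] is within [y / 2] of [c]. *)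
Lemma vanish_near_transfer f p : (\forall w \near p, derivable f w 1) ->
  exists2 r : R, 0 < r & forall a, normc (a - p) < r -> (\forall w \near a, f w = 0) ->
    forall w, normc (w - p) < r -> f w = 0.
Proof.
move=> /derivable_near_bounded[M [r [r0 H]]].
(* A rectangle stays within [3 * y] of its centre, which is within [y / 4] of [p]; hence it stays in
   the disc of radius [r = 4 * y]. *)
pose y := r / 4; have y0 : 0 < y by rewrite divr_gt0.
exists (y / 4) => [|a ap fa c cp]; first by rewrite divr_gt0.
have cpR w : rect c y w -> normc (w - p) < r.
  move=> /rect_normc wc; have -> : w - p = (w - c) + (c - p) by ring.
  apply: le_lt_trans (normcD _ _) _; rewrite /y in wc cp *; lra.
have ca : normc (c - a) < y / 2.
  have -> : c - a = (c - p) + - (a - p) by ring.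
  by apply: le_lt_trans (normcD _ _) _; rewrite normc_opp; lra.
apply: (@vanish_of_far_boundary f a c y M (y / 2)) => // [w /cpR/H[]//|w /cpR/H[]//|].
move=> w [_ wb]; right.
have wc : y <= normc (w - c).
  case: wb => h; first by have := normc_ge_absRe (w - c); lra.
  by have := normc_ge_absIm (w - c); lra.
have := normcD (w - a) (- (c - a)); rewrite normc_opp.
have -> : w - a + - (c - a) = w - c by ring.
lra.
Qed.

(** Vanishing on the real axis is first carried into the upper half plane by
    [vanish_of_far_boundary], with [a] outside the rectangle, and then from an open set there to a
    full disc about 0 by [vanish_near_transfer]. *)
Lemma vanish_of_real f : (\forall w \near (0 : C), derivable f w 1) ->
  (exists2 d : R, 0 < d & forall x : R, `|x| < d -> f x%:C = 0) ->
  \forall w \near (0 : C), f w = 0.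
Proof.
move=> df [d d0 fd].
have [M [r1 [r10 H]]] := derivable_near_bounded df.
have [r2 r20 Htr] := vanish_near_transfer df.
pose r := Num.min d r1.
have [rd rr1] : r <= d /\ r <= r1 by split; rewrite ge_min lexx ?orbT.
have r0 : 0 < r by rewrite lt_min d0.
have upper (x y : R) : 0 < y -> `|x| + 4 * y < r -> f (x +i* y) = 0.
  move=> y0 xyr; set c := x +i* y; pose a : C := x +i* (- (y / 4)).
  have caE : c - a = 0 +i* (y + y / 4).
    by apply/eqP; rewrite eq_complex /= opprK subrr !eqxx.
  have nc : normc c <= `|x| + y.
    by apply: le_trans (normc_le_ReIm _) _; rewrite /= (gtr0_norm y0).
  have cR w : rect c y w -> normc (w - 0) < r1.
    move=> /rect_normc wc; rewrite subr0; have -> : w = (w - c) + c by ring.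
    apply: le_lt_trans (normcD _ _) _; lra.
  (* The rectangle centred at [c] has its lower side on the real axis, and [a] lies
     just below it. *)
  apply: (@vanish_of_far_boundary f a c y M (2 * y)) => // [w /cR/H[]//|w /cR/H[]//| | |].
  - move=> [_ /=]; rewrite ler_norml; lra.
  - move=> w [[wR wI] wb].
    have ReE : complex.Re (w - a) = complex.Re (w - c) by case: (w).
    have ImE : complex.Im (w - a) = complex.Im (w - c) + (y + y / 4).
      by case: (w) => ? ? /=; ring.
    case: wb => [h|]; first by right; have := normc_ge_absRe (w - a); rewrite ReE h.
    case: (ger0P (complex.Im (w - c))) => _ wy.
      right; apply: le_trans (normc_ge_absIm _); apply: le_trans (ler_norm _).
      by rewrite ImE wy; lra.
    left; move: wR wy; case: (w) => wr wi /=; rewrite ler_norml => wR wy.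
    have -> : wi = 0 by lra.
    apply: fd; apply: lt_le_trans rd; apply: le_lt_trans xyr.
    have -> : wr = x + (wr - x) by ring.
    apply: le_trans (ler_normD _ _) _; rewrite lerD2l ler_norml; lra.
  - rewrite caE /= expr0n/= add0r sqrtr_sqr ger0_norm; lra.
(* The disc of radius [e] about [0 +i* e] lies above the real axis, and on it the modulus of the
   real part plus 4 times the imaginary part is below [9 * e], hence below [r]. *)
pose e := Num.min (r2 / 2) (r / 20).
have [er2 er] : e <= r2 / 2 /\ e <= r / 20 by split; rewrite ge_min lexx ?orbT.
have e0 : 0 < e by rewrite lt_min !divr_gt0.
have ne : normc (0 +i* e) = e by rewrite /= expr0n/= add0r sqrtr_sqr gtr0_norm.
apply/nearP; exists r2 => //; apply: (Htr (0 +i* e)).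
  by rewrite subr0 ne; lra.
apply/nearP; exists e => // -[x y] we; apply: upper.
  have := le_lt_trans (normc_ge_absIm _) we; rewrite /= ltr_norml; lra.
have := le_lt_trans (normc_ge_absIm _) we; have := le_lt_trans (normc_ge_absRe _) we.
by rewrite /= subr0 [`|y - e| < _]ltr_norml => xe /andP[? ?]; lra.
Qed.

(** Let [T] be the supremum of the times up to which [f] vanishes near every point of the path.
    Transfer at [G T%:C] carries the vanishing across [T], so [T = 1]. *)
Theorem identity_along_path f (G : C -> C) :
  (forall t : R, 0 <= t <= 1 -> \forall w \near G t%:C, derivable f w 1) ->
  (forall t : R, 0 <= t <= 1 -> {for t%:C, continuous G}) ->
  (\forall w \near G 0, f w = 0) -> f (G 1) = 0.
Proof.
move=> df cG f0.
pose V (t : R) := \forall w \near G t%:C, f w = 0.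
pose S := [set t : R | 0 <= t <= 1 /\ forall s, 0 <= s <= t -> V s].
have S0 : S 0.
  split; first by rewrite lexx ler01.
  by move=> s; rewrite -eq_le => /eqP <-.
have Sub : has_ubound S by exists 1 => t [/andP[]].
have hS : has_sup S by split; [exists 0|].
pose T := sup S.
have T01 : 0 <= T <= 1.
  rewrite ub_le_sup//=; apply: ge_sup; first by exists 0.
  by move=> t [/andP[]].
have [r r0 Hr] := vanish_near_transfer (df _ T01).
have [d d0 Hd] := continuous_normcP (cG _ T01) r0.
have [t [t01 tS] Tt] := sup_adherent d0 hS.
have tT : t <= T by apply: ub_le_sup.
have nT (s : R) : `|s - T| < d -> normc (G s%:C - G T%:C) < r.
  move=> sT; apply: Hd; have -> : s%:C - T%:C = (s - T)%:C by rewrite rmorphB.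
  by rewrite normc_real.
have fr w : normc (w - G T%:C) < r -> f w = 0.
  apply: (Hr (G t%:C)); last by apply: tS; case/andP: t01 => ->; rewrite lexx.
  apply: nT; rewrite ltr_norml; rewrite -/T in Tt; apply/andP; split; lra.
have Vs (s : R) : `|s - T| < d -> V s.
  move=> /nT sT; apply/nearP; exists (r - normc (G s%:C - G T%:C)); first by rewrite subr_gt0.
  move=> w ws; apply: fr; have -> : w - G T%:C = (w - G s%:C) + (G s%:C - G T%:C) by ring.
  apply: le_lt_trans (normcD _ _) _; lra.
have : S (Num.min 1 (T + d / 2)).
  case/andP: T01 => T0 T1; split.
    by rewrite le_min ler01 ge_min lexx/= andbT addr_ge0// divr_ge0// ltW.
  move=> s /andP[s0]; rewrite le_min => /andP[s1 sd].
  have [st|ts] := leP s t; first by apply: tS; rewrite s0.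
  apply: Vs; rewrite ltr_norml; rewrite -/T in Tt; apply/andP; split; lra.
move=> /(ub_le_sup Sub); rewrite -/T ge_min => /orP[T1|h]; last by exfalso; lra.
have -> : 1 = T%:C by congr _%:C; apply: le_anti; case/andP: T01 => _ ->; rewrite T1.
by apply: fr; rewrite subrr normc_zero.
Qed.

End IdentityTheorem.

(** * Uniqueness of the holomorphic extension *)

Section HornerDifferentiable.
Variable R : realType.
Local Notation C := R[i].

Lemma derivable_hornerC (p : {poly C}) (z : C) : derivable (horner p : C -> C) z 1.
Proof.
have step (f g h : C -> C) : derivable f z 1 -> derivable g z 1 -> derivable h z 1 ->
    derivable (f * g + h) z 1.
  by move=> df dg dh; exact: derivableD (derivableM df dg) dh.
elim/poly_ind: p => [|p r ih].
  have -> : (horner (0 : {poly C}) : C -> C) = cst 0 by apply/funext => y; rewrite horner0.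
  exact: derivable_cst.
have -> : (horner (p * 'X + r%:P) : C -> C) = (horner p : C -> C) * id + cst r.
  by apply/funext => y; rewrite !hornerE.
have di : derivable (id : C -> C) z 1 by exact: derivable_id.
have dr : derivable (cst r : C -> C) z 1 by exact: derivable_cst.
exact: (step (horner p) id (cst r) ih di dr).
Qed.

Lemma continuous_hornerC (p : {poly C}) (z : C) : {for z, continuous (horner p)}.
Proof. exact/derivable_continuous/derivable_hornerC. Qed.

Lemma near_neq0 (f : C -> C) (p : C) : {for p, continuous f} -> f p != 0 ->
  \forall w \near p, f w != 0.
Proof.
move=> cf; rewrite -normc_gt0 => fp; have [r r0 H] := continuous_normcP cf fp.
apply/nearP; exists r => // w /H; apply: contraTneq => ->.
by by rewrite sub0r normc_opp ltxx.
Qed.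

Lemma exists_real_notin (s : seq R) : exists x, x \notin s.
Proof.
suff [x Hx] : exists x, forall y, y \in s -> y < x.
  by exists x; apply/negP => /Hx; rewrite ltxx.
elim: s => [|a s [x Hx]]; first by exists 0.
exists (Num.max (a + 1) x) => y; rewrite inE lt_max => /predU1P[->|/Hx->].
  by rewrite ltrDl ltr01.
by rewrite orbT.
Qed.

(* Of the paths z = i t + lam t (1 - t), a root z of Q with 0 < Im z < 1 lies
   only on the one with lam = Re z / (Im z (1 - Im z)). *)
Lemma path_avoiding_roots (Q : {poly C}) : Q.[0] != 0 -> Q.['i%C] != 0 ->
  exists lam : R, forall t : R, 0 <= t <= 1 ->
    Q.['i%C * t%:C + lam%:C * (t%:C * (1 - t%:C))] != 0.
Proof.
move=> Q0 Qi; have [rs Qrs] := closed_field_poly_normal Q.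
have [lam Hlam] := exists_real_notin
  [seq complex.Re z / (complex.Im z * (1 - complex.Im z)) | z <- rs].
exists lam => t /andP[t0 t1].
have [->|tn0] := eqVneq t 0; first by rewrite mul0r !mulr0 addr0.
have [->|tn1] := eqVneq t 1; first by rewrite subrr !mulr0 addr0 mulr1.
set z := 'i%C * _ + _; have zE : z = (lam * (t * (1 - t))) +i* t.
  by apply/eqP; rewrite /z eq_complex /=; apply/andP; split; apply/eqP; ring.
apply: contra Hlam => /eqP Qz; apply/mapP; exists z.
  rewrite -root_prod_XsubC -(@rootZ _ _ (lead_coef Q)).
    by rewrite -Qrs; apply/rootP.
  by rewrite lead_coef_eq0; apply: contraNneq Q0 => ->; rewrite horner0.
by rewrite zE /=; field; rewrite tn0 subr_eq0 eq_sym tn1.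
Qed.

End HornerDifferentiable.

(** * Holomorphic functions along curves, and vanishing on the diagonal *)

Section Uniqueness.
Variables (R : realType) (n : nat).
Local Notation C := R[i].
Implicit Types (s : nat) (x y : 'rV[C]_n.+1).

(** Knowing the default value makes the scaling law and the formula for the twist hold without the
    condition [hatJ != 0]. *)
Lemma hat_point0 s (p : 'rV[C]_n.+1 * 'rV[C]_n.+1) :
  hatJ s p = 0 -> hat_point s p = \pi_(hatMred R n s)%qT (hatZ0 R n s).
Proof.
move=> p0; rewrite /hat_point /insubd insubF//; apply/negbTE/negP => /set_mem.
rewrite /hatZ /= p0 invr0 scale0r => /esym/eqP; rewrite /hatJ big1 ?oner_eq0//.
by move=> k _; rewrite mxE mul0r mulr0.
Qed.

Lemma hat_point_scale s (a b : C) x y : a != 0 -> b != 0 ->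
  hat_point s (a *: x, b *: y) = hat_point s (x, y).
Proof.
move=> a0 b0; have [p0|p0] := eqVneq (hatJ s (x, y)) 0.
  by rewrite !hat_point0// (hatJZ s a b (x, y)) p0 mulr0.
exact: (@hat_pointZ _ _ _ a b (x, y)).
Qed.

Definition affine_coord (i : 'I_n.+1) x : 'rV[C]_n := \row_k (x 0 (lift i k) / x 0 i).

Lemma homog_affine_coord i x : x 0 i != 0 ->
  homog i (affine_coord i x) = (x 0 i)^-1 *: x.
Proof.
move=> xi; apply/matrixP => a k; rewrite !mxE !ord1.
case: unliftP => [j ->|->]; first by rewrite mxE mulrC.
by rewrite mulVf.
Qed.

Lemma hat_point_chart s i j x y : x 0 i != 0 -> y 0 j != 0 ->
  hat_point s (x, y) = hat_chart s i j (affine_coord i x, affine_coord j y).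
Proof.
by move=> xi yj; rewrite /hat_chart /= !homog_affine_coord// hat_point_scale// invr_eq0.
Qed.

Lemma differentiable_affine_coord (U : normedModType C) (X : U -> 'rV[C]_n.+1) u i :
  (forall k, differentiable (fun w => X w 0 k) u) -> X u 0 i != 0 ->
  differentiable (fun w => affine_coord i (X w)) u.
Proof.
move=> dX xi.
have -> : (fun w => affine_coord i (X w)) = \sum_(k < n)
    (fun w => (X w 0 (lift i k) * (X w 0 i)^-1) *: (delta_mx 0 k : 'rV[C]_n)).
  apply/funext => w; rewrite fct_sumE [LHS]row_sum_delta.
  by apply: eq_bigr => k _; rewrite mxE.
apply: differentiable_sum => k; apply: differentiableZl.
by apply: differentiableM => //; apply: differentiableV.
Qed.

(** Some term of the sum is nonzero, so one index serves both factors and the charts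
    [hat_chart s i i] suffice for curves. *)
Lemma hatJ_neq0_coord s x y : hatJ s (x, y) != 0 ->
  exists i, x 0 i != 0 /\ y 0 i != 0.
Proof.
move=> h; apply: contrapT => H; move/eqP: h; apply; rewrite /hatJ big1// => k _ /=.
have [->|xk] := eqVneq (x 0 k) 0; first by rewrite mul0r mulr0.
have [->|yk] := eqVneq (y 0 k) 0; first by rewrite !mulr0.
by exfalso; apply: H; exists k.
Qed.

Lemma holomorphic_curve s (gh : hatMred R n s -> C) (X Y : C -> 'rV[C]_n.+1) (z : C) :
  holomorphic gh -> (forall k w, derivable (fun w : C => X w 0 k) w 1) ->
  (forall k w, derivable (fun w : C => Y w 0 k) w 1) -> hatJ s (X z, Y z) != 0 ->
  derivable (fun w => gh (hat_point s (X w, Y w))) z 1.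
Proof.
move=> hgh dX dY h; have [i [xi yi]] := hatJ_neq0_coord h.
pose c w := (affine_coord i (X w), affine_coord i (Y w)).
apply: (@near_eq_derivable _ _ _ ((gh \o hat_chart s i i) \o c)).
  near=> w; rewrite /= /c -hat_point_chart//.
  - by near: w; apply: near_neq0 xi; exact: derivable_continuous.
  - by near: w; apply: near_neq0 yi; exact: derivable_continuous.
apply/derivable1_diffP/differentiable_comp.
  by apply: differentiable_pair; apply: differentiable_affine_coord => // k;
    exact/derivable1_diffP.
apply: hgh; rewrite /= !homog_affine_coord// (hatJZ s _ _ (X z, Y z)).
by rewrite !mulf_neq0 ?invr_eq0.
Unshelve. all: by end_near. Qed.

Lemma J_real s x : J s x \is Num.real.
Proof.
apply: rpred_sum => k _; apply: realM.
  by rewrite /nu; case: ifP => _; rewrite ?realN real1.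
by apply: ger0_real; rewrite -normCK exprn_ge0.
Qed.

Lemma hatJ_conj s x : hatJ s (x, map_mx Num.conj x) = J s x.
Proof. by apply: eq_bigr => k _; rewrite mxE. Qed.

(** Dividing [x] by the square root of [J s x] normalises it; this factor is real, so it commutes
    with conjugation and leaves the projective points unchanged. *)
Lemma Delta_surj s x : 0 < J s x ->
  exists m : Mred R n s, hat_point s (x, map_mx Num.conj x) = Delta m.
Proof.
move=> J0; pose a := (sqrtC (J s x))^-1.
have a0 : 0 < a by rewrite invr_gt0 sqrtC_gt0.
have aC : Num.conj a = a by apply: conj_Creal; exact: gtr0_real.
have axZ : (a *: x) \in Z (R := R) (n := n) s.
  apply/mem_set; rewrite /Z /= -hatJ_conj.
  have -> : map_mx Num.conj (a *: x) = a *: map_mx Num.conj x.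
    by apply/matrixP => i j; rewrite !mxE rmorphM /= aC.
  rewrite (hatJZ s a a (x, _)) hatJ_conj -expr2 /a exprVn sqrtCK mulVf//.
  by rewrite gt_eqF.
exists (\pi_(Mred R n s)%qT (SigSub axZ)).
rewrite Delta_pi -hat_point_val set_valE /=.
have -> : map_mx Num.conj (a *: x) = a *: map_mx Num.conj x.
  by apply/matrixP => i j; rewrite !mxE rmorphM /= aC.
by rewrite hat_point_scale ?gt_eqF.
Qed.

Theorem holomorphic_eq0 s (gh : hatMred R n s -> C) : (0 < s)%N ->
  holomorphic gh -> (forall m, gh (Delta m) = 0) -> forall w, gh w = 0.
Proof.
move=> s0 hgh gh0 y0.
have [p Jp ->] : exists2 p, hatJ s p = 1 & y0 = hat_point s p.
  exists (set_val (repr y0)); first exact: (set_mem (valP (repr y0))).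
  by rewrite hat_point_val reprK.
case: p Jp => x y Jp.
pose I : C := 'i%C.
have I2 : I * I = -1 by rewrite -expr2 sqr_i.
have I0 : I != 0 by rewrite /I complexiE neq0Ci.
have IC : Num.conj I = - I by rewrite /I complexiE conjCi.
pose r0 k : C := (k == ord0 :> 'I_n.+1)%:R.
(* The coefficients solve xi(0) = eta(0) = e_0, xi(i) = x and eta(i) = y. *)
pose A k : C := r0 k - (x 0 k + Num.conj (y 0 k)) / 2.
pose B k : C := (x 0 k - Num.conj (y 0 k)) / (2 * I).
pose PX k : {poly C} := (r0 k)%:P + B k *: 'X + A k *: 'X^2.
pose PY k : {poly C} := (r0 k)%:P + Num.conj (B k) *: 'X + Num.conj (A k) *: 'X^2.
pose X z : 'rV[C]_n.+1 := \row_k (PX k).[z].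
pose Y z : 'rV[C]_n.+1 := \row_k (PY k).[z].
pose Q : {poly C} := \sum_(k < n.+1) (nu R s k)%:P * (PX k * PY k).
have QE z : Q.[z] = hatJ s (X z, Y z).
  rewrite /Q horner_sum; apply: eq_bigr => k _.
  by rewrite !hornerM hornerC !mxE.
have PXE k z : (PX k).[z] = r0 k + B k * z + A k * (z * z).
  by rewrite /PX 2!hornerD !hornerZ hornerC hornerX hornerXn expr2.
have PYE k z : (PY k).[z] = r0 k + Num.conj (B k) * z + Num.conj (A k) * (z * z).
  by rewrite /PY 2!hornerD !hornerZ hornerC hornerX hornerXn expr2.
have Xi : X I = x.
  apply/matrixP => a k; rewrite ord1 !mxE PXE I2 /B /A.
  by field; rewrite I0.
have Yi : Y I = y.
  apply/matrixP => a k; rewrite ord1 !mxE PYE I2 /B /A.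
  rewrite !rmorphM !rmorphB !rmorphM !rmorphD !fmorphV !rmorphM /= !conjCK IC.
  rewrite !rmorph_nat /=.
  by field; rewrite I0.
(* Both curves start at [e_0], which has sign 1 because [0 < s]. *)
have Q0 : Q.[0] = 1.
  rewrite QE /hatJ (bigD1 ord0)//= big1 => [|k k0].
    by rewrite !mxE PXE PYE /nu s0 /r0 eqxx /=; ring.
  by rewrite !mxE PXE PYE /r0 (negbTE k0) /=; ring.
have Qi : Q.[I] = 1 by rewrite QE Xi Yi.
pose F z := gh (hat_point s (X z, Y z)).
have dX k w : derivable (fun w : C => X w 0 k) w 1.
  have -> : (fun w : C => X w 0 k) = horner (PX k) by apply/funext => v; rewrite mxE.
  exact: derivable_hornerC.
have dY k w : derivable (fun w : C => Y w 0 k) w 1.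
  have -> : (fun w : C => Y w 0 k) = horner (PY k) by apply/funext => v; rewrite mxE.
  exact: derivable_hornerC.
have dF z : Q.[z] != 0 -> \forall w \near z, derivable F w 1.
  move=> Qz; near=> w; apply: holomorphic_curve => //; rewrite -QE.
  by near: w; apply: near_neq0 Qz; exact: continuous_hornerC.
(* At real [t] the curves are conjugate to each other, and [J] is positive for small [t] since [Q]
   is 1 at 0; such points lie in the image of [Delta]. *)
have F0 : \forall w \near (0 : C), F w = 0.
  apply: vanish_of_real; first by apply: dF; rewrite Q0 oner_eq0.
  have [d d0 Hd] := continuous_normcP (@continuous_hornerC _ Q 0) ltr01.
  exists d => // t td; have conjXY : Y t%:C = map_mx Num.conj (X t%:C).
    apply/matrixP => a k; rewrite !mxE PXE PYE.
    have tC : Num.conj t%:C = t%:C by apply: conj_Creal; rewrite complex_real.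
    rewrite !(rmorphD, rmorphM) /= !tC; congr (_ + _ + _).
    by rewrite /r0 rmorph_nat.
  have Jt : 0 < J s (X t%:C).
    have := Hd t%:C; rewrite subr0 normc_real => /(_ td).
    rewrite Q0 QE conjXY hatJ_conj => /(le_lt_trans (normc_ge_absRe _)).
    rewrite -(RRe_real (J_real s (X t%:C))) /= ltr_norml => /andP[+ _].
    by rewrite ltcR; lra.
  by have [m mE] := Delta_surj Jt; rewrite /F conjXY mE gh0.
have [lam Hlam] : exists lam : R, forall t : R, 0 <= t <= 1 ->
    Q.[I * t%:C + lam%:C * (t%:C * (1 - t%:C))] != 0.
  by apply: path_avoiding_roots; rewrite ?Q0 ?Qi oner_eq0.
(* The root-avoiding path written as a polynomial in a complex variable, with value 0 at 0 and [I]
   at 1. *)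
pose G : {poly C} := I *: 'X + lam%:C *: ('X * (1 - 'X)).
have GE (z : C) : G.[z] = I * z + lam%:C * (z * (1 - z)) by rewrite /G !hornerE.
have -> : gh (hat_point s (x, y)) = F G.[1].
  by rewrite GE subrr !mulr0 addr0 mulr1 /F Xi Yi.
apply: identity_along_path => [t t01|t _|]; first by apply: dF; rewrite GE; exact: Hlam.
  exact: continuous_hornerC.
by rewrite GE !mulr0 mul0r mulr0 addr0.
Unshelve. all: by end_near. Qed.

End Uniqueness.

(** * The isomorphism *)

Section CompactConvergence.

(** The image under [phi] of a compact [K] is compact, and closeness on that image is closeness of
    the composites on [K]. *)
Lemma precomp_continuous (X Y : topologicalType) (V : uniformType) (phi : Y -> X) :
  continuous phi ->
  continuous ((fun f => f \o phi) : {family compact, X -> V} -> {family compact, Y -> V}).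
Proof.
move=> cphi; set pre := fun f => f \o phi; move=> f.
have Ff : Filter (nbhs (f : {family compact, X -> V})) by exact: nbhs_filter.
have FF : Filter (pre @ nbhs (f : {family compact, X -> V})) by exact: fmap_filter.
apply/(@fam_cvgP _ _ compact _ (pre f) FF) => K cK P /uniform_nbhs[E [eE EP]].
have cphiK : compact (phi @` K).
  by apply: continuous_compact cK; exact: continuous_subspaceT.
have fE : nbhs (f : {uniform` phi @` K -> V})
    [set g : X -> V | forall x, (phi @` K) x -> E (f x, g x)].
  by apply/uniform_nbhs; exists E; split.
have := (@fam_cvgP _ _ compact _ f Ff).1 (@cvg_id _ _) _ cphiK _ fE.
apply: filterS => g /= gE; apply: EP => y Ky /=; apply: gE; exact: imageP.
Qed.
End CompactConvergence.

Section DiagonalMap.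
Variable K : numFieldType.

Lemma differentiable_fst (V W : normedModType K) (q : V * W) : differentiable fst q.
Proof. apply: linear_differentiable => p; exact: cvg_fst. Qed.

Lemma differentiable_snd (V W : normedModType K) (q : V * W) : differentiable snd q.
Proof. apply: linear_differentiable => p; exact: cvg_snd. Qed.

Lemma differentiable_diag_snd m (V : normedModType K) (c : 'I_m -> K) (q : V * 'rV[K]_m) :
  differentiable (fun q : V * 'rV[K]_m => (q.1, \row_k (c k * q.2 0 k) : 'rV[K]_m)) q.
Proof.
apply: differentiable_pair; first exact: differentiable_fst.
have -> : (fun q : V * 'rV[K]_m => \row_k (c k * q.2 0 k) : 'rV[K]_m) =
   \sum_(k < m) (fun q : V * 'rV[K]_m => (c k * q.2 0 k) *: (delta_mx 0 k : 'rV[K]_m)).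
  apply/funext => w; rewrite fct_sumE [LHS]row_sum_delta.
  by apply: eq_bigr => k _; rewrite mxE.
apply: differentiable_sum => k; apply: differentiableZl.
apply: differentiableM; first exact: differentiable_cst.
apply: (@differentiable_comp _ _ _ _ snd (fun v : 'rV[K]_m => v 0 k)).
  exact: differentiable_snd.
exact: differentiable_coord.
Qed.

End DiagonalMap.

(** * The biholomorphism between the complexified reduced spaces *)

Section Twist.
Variables (R : realType) (n : nat).
Local Notation C := R[i].
Implicit Types (s : nat) (x y : 'rV[C]_n.+1).

Definition twist_sign s s' (k : 'I_n.+1) : C := nu R s k * nu R s' k.

Definition twist s s' y : 'rV[C]_n.+1 := \row_k (twist_sign s s' k * y 0 k).

Lemma twist_signM s s' k : twist_sign s s' k * twist_sign s s' k = 1.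
Proof. by rewrite /twist_sign mulrACA !nuM mulr1. Qed.

Lemma twist_sign_neq0 s s' k : twist_sign s s' k != 0.
Proof.
by apply/eqP => d0; have /eqP := twist_signM s s' k; rewrite d0 mul0r eq_sym oner_eq0.
Qed.

Lemma twistZ s s' (a : C) y : twist s s' (a *: y) = a *: twist s s' y.
Proof. by apply/matrixP => i k; rewrite !mxE mulrCA. Qed.

Lemma twistK s s' y : twist s s' (twist s' s y) = y.
Proof.
apply/matrixP => i k; rewrite ord1 !mxE mulrA.
by rewrite [twist_sign s' s k]mulrC twist_signM mul1r.
Qed.

Lemma hatJ_twist s s' x y : hatJ s (x, twist s s' y) = hatJ s' (x, y).
Proof.
apply: eq_bigr => k _ /=; rewrite mxE /twist_sign.
by rewrite [x 0 k * _]mulrCA !mulrA nuM mul1r.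
Qed.

Lemma twist_hatZ s s' (p : hatZ (R := R) (n := n) s') :
  ((set_val p).1, twist s s' (set_val p).2) \in hatZ (R := R) (n := n) s.
Proof.
apply/mem_set; rewrite /hatZ /= hatJ_twist -surjective_pairing.
exact: (set_mem (valP p)).
Qed.

Definition twist_rep s s' (p : hatZ (R := R) (n := n) s') : hatZ (R := R) (n := n) s :=
  SigSub (twist_hatZ s p).

Lemma set_val_twist_rep s s' (p : hatZ s') :
  set_val (twist_rep s p) = ((set_val p).1, twist s s' (set_val p).2).
Proof. by []. Qed.

Definition twist_hat s s' (w : hatMred R n s') : hatMred R n s :=
  \pi_(hatMred R n s)%qT (twist_rep s (repr w)).

(** The twist commutes with scalars, hence with the action, so the representative chosen in
    [twist_hat] is immaterial. *)
Lemma twist_hat_pi s s' (p : hatZ s') :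
  twist_hat s (\pi_(hatMred R n s')%qT p) = \pi_(hatMred R n s)%qT (twist_rep s p).
Proof.
rewrite /twist_hat.
have /eqmodP/asboolP[a a0 e] : p = repr (\pi_(hatMred R n s')%qT p)
    %[mod {eq_quot (Cstar_equiv R n s')}].
  by rewrite reprK.
apply/esym/eqmodP/asboolP; exists a; first by [].
by rewrite !set_val_twist_rep e /= twistZ.
Qed.

Lemma twist_hat_point s s' x y :
  twist_hat s (hat_point s' (x, y)) = hat_point s (x, twist s s' y).
Proof.
have [p0|p0] := eqVneq (hatJ s' (x, y)) 0.
  (* In the degenerate case both sides are default points; the second component of [hatZ0] carries
     the sign [nu ord0], which the twist exchanges for that of the other signature. *)
  rewrite !hat_point0 ?hatJ_twist// twist_hat_pi; congr (\pi_(_)%qT _).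
  apply: val_inj => /=; congr (_, _); apply/matrixP => i k; rewrite ord1 !mxE.
  have [->|k0] := eqVneq k ord0; last by rewrite !mulr0.
  by rewrite /twist_sign mulrA -[nu R s _ * _ * _]mulrA nuM !mulr1.
rewrite /hat_point twist_hat_pi; congr (\pi_(_)%qT _); apply: val_inj => /=.
have q0 : hatJ s (x, twist s s' y) != 0 by rewrite hatJ_twist.
rewrite set_valE !val_insubd (hat_point_subproof p0) (hat_point_subproof q0) /=.
by rewrite hatJ_twist.
Qed.

Lemma twist_hatK s s' (w : hatMred R n s') : twist_hat s' (twist_hat s w) = w.
Proof.
rewrite -[w]reprK -hat_point_val; case: (set_val _) => x y.
by rewrite !twist_hat_point twistK.
Qed.

Lemma twist_hat_continuous s s' : continuous (@twist_hat s s').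
Proof.
apply/quotient_continuous.
have -> : @twist_hat s s' \o \pi_(hatMred R n s')%qT
    = \pi_(hatMred R n s)%qT \o @twist_rep s s'.
  by apply/funext => p /=; rewrite twist_hat_pi.
have cT : continuous (@twist_rep s s').
  apply: continuous_comp_initial => p.
  apply: (@continuous_comp _ _ _ set_val (fun q => (q.1, twist s s' q.2))).
    exact: initial_continuous.
  exact/differentiable_continuous/differentiable_diag_snd.
by move=> p; apply: continuous_comp; [exact: cT | exact: pi_continuous].
Qed.

Lemma holomorphic_twist s s' (gh : hatMred R n s -> C) :
  holomorphic gh -> holomorphic (gh \o @twist_hat s s').
Proof.
move=> hgh i j p h.
(* In affine charts the twist is linear and diagonal. The factor at [j] restores the coordinate 1 in
   slot [j], since signs square to 1. *)
pose c (k : 'I_n) := twist_sign s s' j * twist_sign s s' (lift j k).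
pose L (q : 'rV[C]_n * 'rV[C]_n) := (q.1, \row_k (c k * q.2 0 k) : 'rV[C]_n).
have homogL (v : 'rV[C]_n) :
    homog j (\row_k (c k * v 0 k)) = twist_sign s s' j *: twist s s' (homog j v).
  apply/matrixP => a k; rewrite ord1 !mxE.
  case: unliftP => [l ->|->]; first by rewrite !mxE mulrA.
  by rewrite mulr1 twist_signM.
have -> : (gh \o @twist_hat s s') \o hat_chart s' i j = (gh \o hat_chart s i j) \o L.
  apply/funext => q; rewrite /= /hat_chart twist_hat_point /L /= homogL.
  by rewrite -[homog i q.1 in RHS]scale1r hat_point_scale ?oner_eq0// twist_sign_neq0.
apply: differentiable_comp; first exact: differentiable_diag_snd.
apply: hgh; rewrite /L /= homogL -[homog i p.1]scale1r.
rewrite (hatJZ s _ _ (homog i p.1, twist s s' _)) mul1r hatJ_twist.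
by rewrite mulf_neq0// twist_sign_neq0.
Qed.

End Twist.

(** * Pulling back the extensions *)

Section Isomorphism.
Variables (R : realType) (n : nat).
Local Notation C := R[i].
Implicit Types s : nat.

Lemma ext_Delta s (g : Ared R n s) m : ext g (Delta m) = g m.
Proof. by rewrite [in RHS](extP g).2. Qed.

(** [ext] is an arbitrary choice among extensions; this determines it, and thereby makes it
    compatible with the algebra operations. *)
Lemma ext_unique s (g : Ared R n s) (gh : hatMred R n s -> C) : (0 < s)%N ->
  holomorphic gh -> (forall m, g m = gh (Delta m)) -> ext g = gh.
Proof.
move=> s0 hgh gE; have [he e] := extP g; apply/funext => w.
have d0 m : (ext g - gh) (Delta m) = 0.
  have -> : (ext g - gh) (Delta m) = ext g (Delta m) - gh (Delta m) by [].
  by rewrite -gE e subrr.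
have : (ext g - gh) w = 0 by exact: (holomorphic_eq0 s0 (holomorphicB he hgh) d0).
by move/eqP; rewrite subr_eq0 => /eqP.
Qed.

(** In general the twist does not map the diagonal to the diagonal, so an element is extended,
    composed with the twist, and then restricted. *)
Lemma pullback_subproof s s' (g : Ared R n s) :
  (ext g \o twist_hat s (s' := s')) \o Delta (s := s') \in extendable (R := R) (n := n) (s := s').
Proof.
apply/asboolP; exists (ext g \o twist_hat s (s' := s')) => //.
by apply: holomorphic_twist; have [] := extP g.
Qed.

Definition pullback s s' (g : Ared R n s) : Ared R n s' := MkAred (pullback_subproof s' g).

Lemma ext_pullback s s' (g : Ared R n s) : (0 < s')%N ->
  ext (pullback s' g) = ext g \o twist_hat s (s' := s').
Proof.
move=> s'0; apply: (ext_unique s'0) => [|m //]; apply: holomorphic_twist.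
by have [] := extP g.
Qed.

Lemma extD s (f g : Ared R n s) : (0 < s)%N -> ext (f + g) = ext f + ext g.
Proof.
move=> s0; have [hf _] := extP f; have [hg _] := extP g.
apply: (ext_unique s0) => [|m].
  by move=> i j p h; apply: differentiableD; [exact: hf | exact: hg].
by transitivity (ext f (Delta m) + ext g (Delta m)) => //; rewrite !ext_Delta.
Qed.

Lemma extM s (f g : Ared R n s) : (0 < s)%N -> ext (f * g) = ext f * ext g.
Proof.
move=> s0; have [hf _] := extP f; have [hg _] := extP g.
apply: (ext_unique s0) => [|m]; first exact: holomorphicM.
by transitivity (ext f (Delta m) * ext g (Delta m)) => //; rewrite !ext_Delta.
Qed.

Lemma ext1 s : (0 < s)%N -> ext (1 : Ared R n s) = cst 1.
Proof. by move=> s0; apply: (ext_unique s0) => [|m //]; exact: holomorphic_cst. Qed.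

Lemma extZ s (c : C) (g : Ared R n s) : (0 < s)%N -> ext (c *: g) = cst c * ext g.
Proof.
move=> s0; have [hg _] := extP g.
apply: (ext_unique s0) => [|m].
  by apply: holomorphicM; [exact: holomorphic_cst | exact: hg].
by transitivity (c * ext g (Delta m)) => //; rewrite ext_Delta.
Qed.

Lemma pullback_linear s s' : (0 < s)%N -> linear (pullback s' : Ared R n s -> _).
Proof.
move=> s0 c f g; apply: val_inj; apply/funext => m /=.
by rewrite extD// extZ.
Qed.

Lemma pullback_monoid_morphism s s' : (0 < s)%N ->
  monoid_morphism (pullback s' : Ared R n s -> _).
Proof.
move=> s0; split=> [|f g]; apply: val_inj; apply/funext => m /=.
  by rewrite ext1.
by rewrite extM.
Qed.

Lemma pullbackK s s' : (0 < s')%N -> cancel (pullback s' : Ared R n s -> _) (pullback s).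
Proof.
move=> s'0 g; apply: val_inj; apply/funext => m /=.
by rewrite ext_pullback//= twist_hatK ext_Delta.
Qed.

Lemma pullback_continuous s s' : (0 < s')%N -> continuous (pullback s' : Ared R n s -> _).
Proof.
move=> s'0; apply: continuous_comp_initial.
have -> : ext (s := s') \o pullback s' =
    (fun f => f \o twist_hat s (s' := s')) \o ext (R := R) (n := n) (s := s).
  by apply/funext => g /=; rewrite ext_pullback.
move=> g; apply: (@continuous_comp (Ared R n s) {family compact, hatMred R n s -> C}
  {family compact, hatMred R n s' -> C} (@ext R n s)).
  exact: (@initial_continuous _ _ (@ext R n s : _ -> {family compact, hatMred R n s -> C}) g).
exact/precomp_continuous/twist_hat_continuous.
Qed.

End Isomorphism.

Theorem mainTheorem3 (R : realType) (n s s' : nat) (hn : (1 <= n)%N)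
  (hs : (1 <= s <= 1 + n)%N) (hs' : (1 <= s' <= 1 + n)%N) :
  exists (Phi : Ared R n s -> Ared R n s') (Psi : Ared R n s' -> Ared R n s),
    [/\ linear Phi, monoid_morphism Phi, cancel Phi Psi, cancel Psi Phi
      & continuous Phi /\ continuous Psi].
Proof.
case/andP: hs hs' => s0 _ /andP[s'0 _].
exists (@pullback R n s s'), (@pullback R n s' s); split.
- exact: pullback_linear.
- exact: pullback_monoid_morphism.
- exact: pullbackK.
- exact: pullbackK.
- by split; exact: pullback_continuous.
Qed.
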